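(* Let $d\ge2$, let $k$ be an integer with $1\le k\le d+1$, and let $\gamma=(\gamma_1,\dots,\gamma_{d-k+1})$ with $\gamma_i>-1$ (no $\gamma$ if $k=d+1$). Let $B=\{d-k+2,\dots,d+1\}$. Define $\mathcal U_n^d(W_{\gamma,-\mathbf 1_k})$ as follows. (i) $k=1$: $\mathcal U_0^d=\mathrm{span}\{1\}$ and for $n\ge1$, $\mathcal U_n^d(W_{\gamma,-1})=x_{d+1}\mathcal V_{n-1}^d(W_{\gamma,1})+H_{n,\{d+1\}}^d(W_{(\gamma,0)})$. (ii) $2\le k\le d$: $\mathcal U_0^d=\mathrm{span}\{1\}$ and for $n\ge1$, $\mathcal U_n^d(W_{\gamma,-\mathbf 1_k})=x_B\,\mathcal V_{n-k}^d(W_{\gamma,\mathbf 1_k})+\sum_{j=1}^{k-1}\sum_{J\subset B,|J|=j}x_J\,H^d_{n-j,B\setminus J}(W_{\varepsilon^J})+H_{n,B}^d(W_{(\gamma,\mathbf 0_k)})$. (iii) $k=d+1$: $\mathcal U_0^d=\mathrm{span}\{1\}$, $\mathcal U_1^d=\mathrm{span}\{x_1+c_1,\dots,x_d+c_d\}$ with arbitrary real $c_1,\dots,c_d$, and for $n\ge2$, $\mathcal U_n^d(W_{-\mathbf 1})=x_1\cdots x_{d+1}\mathcal V_{n-d-1}^d(W_{\mathbf 1})+\sum_{j=2}^{d}\sum_{J\subset\{1,\dots,d+1\},|J|=j}x_J\,H^d_{n-j,\{1,\dots,d+1\}\setminus J}(W_{\varepsilon^J})$. Then every element of $\mathcal U_n^d(W_{\gamma,-\mathbf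 1_k})$ is a polynomial solution of $L_{(\gamma,-\mathbf 1_k)}u=-n(n+|\gamma|+d-k)u$, $\dim\mathcal U_n^d(W_{\gamma,-\mathbf 1_k})=\binom{n+d-1}{n}$, and the displayed sums are direct.
   Context: $x\in\mathbb R^d$, $|x|=x_1+\dots+x_d$, $x_{d+1}:=1-|x|$, $T^d=\{x:x_i\ge0,\ 1-|x|\ge0\}$; for $J\subset\{1,\dots,d+1\}$, $x_J=\prod_{i\in J}x_i$. For $\boldsymbol\varepsilon\in\mathbb R^{d+1}$, $W_{\boldsymbol\varepsilon}=\prod_{i=1}^{d+1}x_i^{\varepsilon_i}$ and $|\boldsymbol\varepsilon|=\sum\varepsilon_i$; $(\gamma,-\mathbf 1_k)$, $(\gamma,\mathbf 1_k)$, $(\gamma,\mathbf 0_k)$ denote $\gamma$ followed by $k$ entries $-1$, $1$, $0$; $|\gamma|=\sum_i\gamma_i$. For $J\subset B$, $\varepsilon^J\in\mathbb R^{d+1}$ has $\varepsilon^J_i=\gamma_i$ for $i\le d-k+1$, $\varepsilon^J_i=1$ for $i\in J$, $\varepsilon^J_i=0$ for $i\in B\setminus J$. For parameters $>-1$, $\mathcal V_m^d(W)$ is the space of polynomials of degree $m$ orthogonal in $L^2(W,T^d)$ to all polynomials of degree $\le m-1$. The operator: $L_{\boldsymbol\varepsilon}=\sum_{i=1}^dx_i(1-x_i)\partial_i^2-2\sum_{i<j\le d}x_ix_j\partial_i\partial_j+\sum_{i=1}^d(\varepsilon_i+1-(|\boldsymbol\varepsilon|+d+1)x_i)\partial_i$.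 Face spaces: for $S\subset\{1,\dots,d+1\}$ and $\boldsymbol\varepsilon$ with $\varepsilon_i>-1$ for $i\notin S$, choose $r\notin S$ ($r=d+1$ if $d+1\notin S$, else a fixed element of $\{1,\dots,d\}\setminus S$); $A=\{1,\dots,d+1\}\setminus(S\cup\{r\})$, $D_i=\partial/\partial x_i-\partial/\partial x_r$ with $\partial/\partial x_{d+1}:=0$; for $\mathbf m\in\mathbb N_0^A$, $R_{\mathbf m}=\big(\prod_{i\in A\cup\{r\}}x_i^{-\varepsilon_i}\big)\prod_{i\in A}D_i^{m_i}\big[\big(\prod_{i\in A}x_i^{\varepsilon_i+m_i}\big)x_r^{\varepsilon_r+|\mathbf m|}\big]$, and $H_{m,S}^d(W_{\boldsymbol\varepsilon})=\mathrm{span}\{R_{\mathbf m}:|\mathbf m|=m\}$ (independent of $\varepsilon_i$, $i\in S$). Conventions: all spaces with negative index are $\{0\}$, and $H_{m,S}^d=\{0\}$ whenever $|S|\ge d$. *)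

(* Defs.v *)
From HB Require Import structures.
From mathcomp Require Import all_boot all_order all_algebra.
From mathcomp Require Import all_classical all_reals all_analysis.
From mathcomp Require mpoly.
Import (canonicals, coercions) mpoly.
Set Implicit Arguments. Unset Strict Implicit. Unset Printing Implicit Defensive.
Import Order.TTheory GRing.Theory Num.Theory.
Import numFieldNormedType.Exports.
Local Open Scope ring_scope.

(* Conventions.  Indices 1..d+1 of the paper are encoded as 'I_(d.+1) = {0..d};
   the paper's index i corresponds to i-1, so x_{d+1} is the index ord_max = d.
   Points of R^d are row vectors 'rV[R]_d.  Polynomials in x_1..x_d are
   multivariate polynomials mpoly.mpoly d R (variable j : 'I_d is x_{j+1}). *)

Section Defs.
Variables (R : realType) (d : nat).

Local Notation poly := (mpoly.mpoly d R).
Local Notation pt := 'rV[R]_d.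

Definition Xv (j : 'I_d) : poly := mpoly.mpolyX R (mpoly.mnm1 j).
Definition cst (c : R) : poly := mpoly.mpolyC d c.
(* the polynomial x_i, i in {1..d+1}, with x_{d+1} = 1 - |x| *)
Definition Xp (i : 'I_d.+1) : poly :=
  oapp Xv (1 - \sum_(j < d) Xv j) (insub (val i)).
Definition xJ (J : {set 'I_d.+1}) : poly := \prod_(i in J) Xp i.
(* msize p = 1 + total degree of p (0 for p = 0) *)
Definition msz (p : poly) : nat := @mpoly.mmeasure _ _ (@mpoly.mdeg d) p.
Definition pd (j : 'I_d) (p : poly) : poly := mpoly.mderiv j p.
Definition ev (p : poly) (x : pt) : R := mpoly.meval (fun j => x ord0 j) p.

Definition xc (x : pt) (i : 'I_d.+1) : R :=
  oapp (fun j => x ord0 j) (1 - \sum_(j < d) x ord0 j) (insub (val i)).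
Definition simplex : set pt := [set x | forall i, 0 <= xc x i].
Definition interior : set pt := [set x | forall i, 0 < xc x i].
Definition W (e : 'I_d.+1 -> R) (x : pt) : R := \prod_i (xc x i) `^ (e i).

(* Lebesgue integral over R^d, written as the iterated (Fubini) integral of
   one-dimensional Lebesgue integrals. *)
Fixpoint iint (n : nat) (F : seq R -> R) : R :=
  match n with
  | 0 => F [::]
  | n'.+1 => Rintegral (@lebesgue_measure R) setT
               (fun t => iint n' (fun s => F (t :: s)))
  end.
Definition intT (f : pt -> R) : R :=
  iint d (fun s => let x : pt := \row_(j < d) nth 0 s j in
                   \1_simplex x * f x).

Definition space := poly -> Prop.
Definition zsp : space := fun p => p = 0.
Definition spanL (s : seq poly) : space :=
  fun p => exists c : 'I_(size s) -> R, p = \sum_(i < size s) c i *: s`_i.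
Definition mulsp (q : poly) (S : space) : space :=
  fun p => exists u, S u /\ p = q * u.
Definition sumsp (F : seq space) : space :=
  fun p => exists u : 'I_(size F) -> poly,
    (forall i : 'I_(size F), nth zsp F i (u i)) /\ p = \sum_i u i.
Definition direct (F : seq space) : Prop :=
  forall u : 'I_(size F) -> poly, (forall i : 'I_(size F), nth zsp F i (u i)) ->
    \sum_i u i = 0 -> forall i, u i = 0.
Definition has_dim (S : space) (N : nat) : Prop :=
  exists b : 'I_N -> poly,
    [/\ forall i, S (b i),
        forall c : 'I_N -> R, \sum_i c i *: b i = 0 -> forall i, c i = 0
      & forall p, S p -> exists c : 'I_N -> R, p = \sum_i c i *: b i].

Definition Vsp (e : 'I_d.+1 -> R) (m : int) : space :=
  fun p => match m with
  | Posz m' => (msz p <= m'.+1)%N /\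
      forall q, (msz q <= m')%N -> intT (fun x => ev p x * ev q x * W e x) = 0
  | Negz _ => p = 0
  end.

Definition rS (S : {set 'I_d.+1}) : 'I_d.+1 :=
  if ord_max \notin S then ord_max else odflt ord_max [pick i | i \notin S].
Definition AS (S : {set 'I_d.+1}) : {set 'I_d.+1} := ~: (S :|: [set rS S]).
(* unit vector e_i in R^d, with e_{d+1} := 0 *)
Definition evec (i : 'I_d.+1) : pt :=
  oapp (fun j => delta_mx 0 j) 0 (insub (val i)).
(* D_i = d/dx_i - d/dx_r, i.e. the directional derivative along e_i - e_r *)
Definition Dop (S : {set 'I_d.+1}) (i : 'I_d.+1) (g : pt -> R) : pt -> R :=
  fun x => derive g x (evec i - evec (rS S)).
(* R_mm for a multi-index mm supported on A with |mm| = m *)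
Definition Rfun (S : {set 'I_d.+1}) (e : 'I_d.+1 -> R) (m : nat)
    (mm : 'I_d.+1 -> nat) : pt -> R :=
  let r := rS S in let A := AS S in
  let g := fun x : pt => (\prod_(i in A) (xc x i) `^ (e i + (mm i)%:R))
                         * (xc x r) `^ (e r + m%:R) in
  let h := foldr (fun i h => iter (mm i) (Dop S i) h) g (enum A) in
  fun x => (\prod_(i in A :|: [set r]) (xc x i) `^ (- e i)) * h x.
Definition Hsp (S : {set 'I_d.+1}) (e : 'I_d.+1 -> R) (m : int) : space :=
  fun p => match m with
  | Posz m' =>
      if (d <= #|S|)%N then p = 0 else
      exists c : {ffun 'I_d.+1 -> 'I_m'.+1} -> R,
        forall x, interior x ->
          ev p x = \sum_(mm : {ffun 'I_d.+1 -> 'I_m'.+1} |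
                           ((\sum_(i in AS S) (mm i : nat))%N == m') &&
                           [forall i, (i \notin AS S) ==> ((mm i : nat) == 0%N)])
                     c mm * Rfun S e m' (fun i => (mm i : nat)) x
  | Negz _ => p = 0
  end.

Definition Lop (e : 'I_d.+1 -> R) (u : poly) : poly :=
  \sum_(i < d) (Xv i * (1 - Xv i)) * pd i (pd i u)
  - cst 2 * \sum_(i < d) \sum_(j < d | (i < j)%N) (Xv i * Xv j) * pd i (pd j u)
  + \sum_(i < d) (cst (e (widen_ord (leqnSn d) i) + 1)
                  - cst (\sum_l e l + d.+1%:R) * Xv i) * pd i u.

Definition Bset (k : nat) : {set 'I_d.+1} := [set i : 'I_d.+1 | (d.+1 - k <= i)%N].
Definition gvec (gam : 'I_d.+1 -> R) (k : nat) (c : R) : 'I_d.+1 -> R :=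
  fun i => if (i < d.+1 - k)%N then gam i else c.
Definition epsJ (gam : 'I_d.+1 -> R) (k : nat) (J : {set 'I_d.+1}) : 'I_d.+1 -> R :=
  fun i => if (i < d.+1 - k)%N then gam i else if i \in J then 1 else 0.
Definition abs_gam (gam : 'I_d.+1 -> R) (k : nat) : R :=
  \sum_(i < d.+1 | (i < d.+1 - k)%N) gam i.

Definition Ufam (gam : 'I_d.+1 -> R) (k n : nat) : seq space :=
  let B := Bset k in
  if (k <= d)%N then
    mulsp (xJ B) (Vsp (gvec gam k 1) (n%:Z - k%:Z))
    :: [seq mulsp (xJ J) (Hsp (B :\: J) (epsJ gam k J) (n%:Z - #|J|%:Z))
       | J <- enum [set J : {set 'I_d.+1} | (J \subset B) && (1 <= #|J| <= k.-1)%N]]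
    ++ [:: Hsp B (gvec gam k 0) n%:Z]
  else
    mulsp (xJ [set: 'I_d.+1]%SET) (Vsp (fun _ => 1) (n%:Z - d.+1%:Z))
    :: [seq mulsp (xJ J) (Hsp (~: J) (epsJ gam k J) (n%:Z - #|J|%:Z))
       | J <- enum [set J : {set 'I_d.+1} | (2 <= #|J| <= d)%N]].

Definition Usp (gam : 'I_d.+1 -> R) (c : 'I_d -> R) (k n : nat) : space :=
  if n == 0%N then spanL [:: 1]
  else if (k == d.+1) && (n == 1%N) then
    spanL [seq Xv i + cst (c i) | i <- enum 'I_d]
  else sumsp (Ufam gam k n).

End Defs.

(* Main.v *)
(* Everything is lifted to homogeneous polynomials in d+1 variables:
   phi : X_i |-> x_i, X_{d+1} |-> 1 - |x| is injective on forms of a fixed degree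
   N, and by Euler's relations L_e (phi F) = phi (lap_e F) - N (N + |e| + d) phi F,
   where lap_e = sum_i (X_i d_i^2 + (e_i + 1) d_i).  So it suffices to produce
   lap-harmonic forms.  The Rodrigues step rho (divide the weight out of
   (d_i - d_r) [X_i X_r W_e G]) intertwines the lap of consecutive weights; hence
   R_m = phi Q_m with Q_m harmonic, free of X_i for i in S, and equal to a nonzero
   multiple of X^m modulo X_r.  This gives dim H_{m,S}.  For S empty, integration
   by parts (read off Dirichlet's integral) and positivity of the weight X_r W_e
   identify V_m with H_{m, empty}, so that all summands have the form x_J H.
   Multiplication by x_J turns lap with exponent 1 on J into lap with exponent -1.
   Every monomial of the lift of an element of x_J H involves, among the variables
   of B, exactly those of J: the sum is therefore direct, and Vandermonde's
   convolution adds up the dimensions. *)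
Require Import Defs.
From HB Require Import structures.
From mathcomp Require Import all_boot all_order all_algebra.
From mathcomp Require Import all_classical all_reals all_analysis.
From mathcomp Require Import measurable_realfun.
From mathcomp Require Import ring lra zify.
From mathcomp Require mpoly.
Import -(notations) mpoly.
Import Order.TTheory GRing.Theory Num.Theory.
Import numFieldNormedType.Exports.
Set Implicit Arguments.
Unset Strict Implicit.
Unset Printing Implicit Defensive.
Local Open Scope ring_scope.

Local Notation XU i := (mpolyX _ (mnm1 i)).
Local Notation C c := (mpolyC _ c).
Local Notation d_ := mderiv.
Local Notation homog N := (ishomog1 N mdeg).

(** * The homogeneous operator and its raising operators *)

Section Polynomials.
Variables (R : realType) (n : nat).
Implicit Types (p q F G : mpoly n R) (i j r : 'I_n) (e : 'I_n -> R).

(** On forms of degree [n] the eigenvalue depends only on [n] and the total exponent. Hence summands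
    built from different weights [epsJ] are all eigenfunctions of one operator, the one with
    exponents -1 on [B], for the same eigenvalue. Real exponents resist algebra: a function is
    therefore kept as an exponent vector together with a polynomial cofactor, and powers are
    differentiated in one place, [Dop_weight]. The index [r] lies outside [S], where exponents
    exceed -1; this keeps the leading coefficients of the Rodrigues polynomials, products of factors
    [-(f r + 1)], away from 0. Weights may be unbounded near the boundary, so boundary terms cannot
    simply be dropped. That a total derivative integrates to 0 is instead checked on monomials,
    where it is a relation between Dirichlet constants. For [k = d + 1] the sets with at most one
    element are absent. Their spaces vanish by convention, and the binomial count agrees with this
    only from degree 2 on; degrees 0 and 1 are treated by hand. *)

Lemma mpoly_mulind (Q : mpoly n R -> Prop) :
  (forall c, Q (C c)) -> (forall p q, Q p -> Q q -> Q (p + q)) ->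
  (forall i p, Q p -> Q (XU i * p)) -> forall p, Q p.
Proof.
move=> QC QD QM; elim/mpolyind => [|c m p _ _ Qp]; first by rewrite -mpolyC0.
apply: QD => //; rewrite mpolyXE_id.
have -> : c *: \prod_(i < n) XU i ^+ m i = (\prod_(i < n) XU i ^+ m i) * C c.
  by rewrite mulrC mul_mpolyC.
elim: (index_enum _) => [|i s IH]; first by rewrite big_nil mul1r.
rewrite big_cons -mulrA; elim: (m i) => [|k IHk]; first by rewrite expr0 mul1r.
by rewrite exprS -mulrA; apply: QM.
Qed.

Lemma mderivXU i j : d_ i (XU j : mpoly n R) = (i == j)%:R.
Proof.
rewrite mderivX mnm1E eq_sym; case: eqP => [->|_]; last by rewrite scale0r.
rewrite scale1r -[RHS]mpolyX0; congr mpolyX.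
by apply/mnmP => k; rewrite mnmBE mnm0E subnn.
Qed.

Lemma mderiv_nat i k : d_ i (k%:R : mpoly n R) = 0.
Proof. by rewrite -mpolyC_nat mderivC. Qed.

(* The operator [Lop] before dehomogenization, see [Lop_phi]. *)
Definition lap e F := \sum_i (XU i * d_ i (d_ i F) + C (e i + 1) * d_ i F).

(* [X^-e (d_i - d_r) (X_i X_r X^e G)]. *)
Definition rho e i r G :=
  C (e i + 1) * (XU r * G) - C (e r + 1) * (XU i * G)
  + XU i * XU r * (d_ i G - d_ r G).

Definition bump2 e i r : 'I_n -> R := fun j => e j + (j == i)%:R + (j == r)%:R.

Lemma rhoD e i r : {morph rho e i r : F G / F + G}.
Proof. by move=> F G; rewrite /rho !mderivD; ring. Qed.

Lemma rho_sum e i r (I : finType) (P : pred I) (F : I -> mpoly n R) :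
  rho e i r (\sum_(a | P a) F a) = \sum_(a | P a) rho e i r (F a).
Proof.
apply: (big_morph _ (rhoD e i r)).
by rewrite /rho !mderiv0 !mulr0 !subrr mulr0 addr0.
Qed.

Lemma lapD e : {morph lap e : F G / F + G}.
Proof.
move=> F G; rewrite /lap -big_split; apply: eq_bigr => i _ /=.
by rewrite !mderivD; ring.
Qed.

Lemma lap_sum e (I : finType) (P : pred I) (F : I -> mpoly n R) :
  lap e (\sum_(a | P a) F a) = \sum_(a | P a) lap e (F a).
Proof.
apply: (big_morph _ (lapD e)).
by rewrite /lap big1 // => i _; rewrite !mderiv0 !mulr0 addr0.
Qed.

Lemma lapZ e c F : lap e (c *: F) = c *: lap e F.
Proof.
rewrite /lap scaler_sumr; apply: eq_bigr => i _.
by rewrite !mderivZ scalerDr -!scalerAr.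
Qed.

(** Formally [rho e i r] is minus the adjoint of [d_i - d_r] between the weights [e] and
    [bump2 e i r], and [lap] is symmetric for its weight. The adjoint relation [(d_i - d_r) lap_e =
    lap_(bump2 e i r) (d_i - d_r)] holds because the two mixed terms [d_i d_r] cancel. The proof is
    the direct computation. *)
Lemma lap_rho e i r G : i != r ->
  lap e (rho e i r G) = rho e i r (lap (bump2 e i r) G).
Proof.
move=> ir; have ri : r != i by rewrite eq_sym.
have f0 : false%:R = 0 :> mpoly n R by [].
rewrite /lap rho_sum.
(* The summands at [i] and [r] are compared jointly; each of the others commutes with [rho] by
   itself. *)
rewrite (bigD1 i) // (bigD1 r) //= [RHS](bigD1 i) // [X in _ = _ + X](bigD1 r) //=.
rewrite !addrA; congr (_ + _); last first.
  apply: eq_bigr => j /andP[ji jr].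
  rewrite /rho /bump2 (negbTE ji) (negbTE jr) !addr0.
  rewrite !(mderivD, mderivB, mderivM, mderivC, mderivN, mderivXU, mderiv_nat).
  rewrite !(mderiv_comm i j) !(mderiv_comm r j).
  rewrite !(eq_sym i j) !(eq_sym r j) (negbTE ji) (negbTE jr).
  rewrite f0.
  ring.
rewrite /rho /bump2 !eqxx (negbTE ir) (negbTE ri) !addr0.
rewrite !(mderivD, mderivB, mderivM, mderivC, mderivN, mderivXU, mderiv_nat).
rewrite !(mderiv_comm r i) !eqxx (negbTE ir) (negbTE ri).
rewrite ?f0 ?mulr1n ?addr0 !mpolyCD ?mpolyC1.
ring.
Qed.

End Polynomials.

(** * Identity principle, homogeneous forms, reduction modulo a variable *)

Section Structure.
Variables (R : realType) (n : nat).
Implicit Types (p q F G : mpoly n R) (i j r : 'I_n) (e : 'I_n -> R).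

Lemma msize_leP p k :
  (forall m, mcoeff m p != 0 -> (mdeg m < k)%N) -> (mmeasure mdeg p <= k)%N.
Proof.
move=> H; rewrite mmeasureE big_seq; elim/big_ind: _ => // [a b ha hb|m].
  by rewrite geq_max ha hb.
by rewrite mcoeff_msupp; apply: H.
Qed.

Lemma msize_mderiv p k i :
  (mmeasure mdeg p <= k.+1)%N -> (mmeasure mdeg (d_ i p) <= k)%N.
Proof.
move=> hp; apply: msize_leP => m; rewrite mcoeff_mderiv => h.
have : mcoeff (mnm_add m (mnm1 i)) p != 0.
  by apply: contraNneq h => ->; rewrite mul0rn.
rewrite -mcoeff_msupp => /(mmeasure_mnm_lt mdeg) /leq_trans /(_ hp).
by rewrite /= mdegD mdeg1 addn1.
Qed.

(** The passage to one variable. It serves twice: for the identity principle on a box and for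
    directional derivatives in the Rodrigues formula. *)
Lemma mpoly_line p (v c : 'I_n -> R) : exists g : {poly R}, forall t,
  let w j := v j + t * c j in
  g.[t] = meval w p /\ (g^`()).[t] = \sum_i c i * meval w (d_ i p).
Proof.
elim/mpoly_mulind: p => [x|p q [g hg] [h hh]|j p [g hg]].
- exists x%:P => t; rewrite /= derivC !hornerC mevalC big1 ?horner0 // => i _.
  by rewrite mderivC meval0 mulr0.
- exists (g + h) => t; have [a b] := hg t; have [a' b'] := hh t.
  rewrite /= derivD !hornerD mevalD a b a' b' -big_split; split=> //.
  by apply: eq_bigr => i _ /=; rewrite mderivD mevalD mulrDr.
- exists (((v j)%:P + (c j)%:P * 'X) * g) => t; have [a b] := hg t; split=> /=.
    by rewrite !hornerE a mevalM mevalXU (mulrC t).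
  rewrite derivM derivD derivM derivX !derivC mul0r add0r mulr1 !hornerE a b.
  under [RHS]eq_bigr do rewrite mderivM mevalD !mevalM mevalXU mderivXU mulrDr.
  rewrite big_split /=; congr (_ + _).
    rewrite (bigD1 j) //= eqxx meval1 mul1r big1 ?addr0 // => i ij.
    by rewrite (negbTE ij) meval0 mul0r mulr0.
  by rewrite mulr_sumr; apply: eq_bigr => i _; rewrite (mulrC t) mulrCA.
Qed.

Lemma poly_eq0_itv (g : {poly R}) (a b : R) : a < b ->
  (forall t, a < t < b -> g.[t] = 0) -> g = 0.
Proof.
move=> ab hg; apply: contrapT => /eqP g0.
(* The denominators start at 2, which keeps the points strictly inside the interval; [size g]
   distinct roots are one more than the degree allows. *)
pose s := [seq a + (b - a) / (k.+2)%:R | k <- iota 0 (size g)].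
have us : uniq s.
  rewrite map_inj_uniq ?iota_uniq // => k l /addrI /mulfI.
  rewrite subr_eq0 (gt_eqF ab) => /(_ isT) /invr_inj /eqP.
  by rewrite eqr_nat => /eqP [].
have as_ : all (root g) s.
  apply/allP => _ /mapP[k _ ->]; apply/eqP/hg.
  have ba : 0 < b - a by rewrite subr_gt0.
  rewrite ltrDl divr_gt0 //= -ltrBrDl ltr_pdivrMr // ltr_pMr //.
  by rewrite ltr1n.
by have := max_poly_roots g0 as_ us; rewrite size_map size_iota ltnn.
Qed.

Lemma mderiv_eq0_const p : (forall i, d_ i p = 0) -> p = C (mcoeff mnm0 p).
Proof.
move=> dp; apply/mpolyP => m; rewrite mcoeffC.
have [<-|/eqP m0] := eqVneq mnm0 m; first by rewrite mulr1.
rewrite mulr0; have [i mi] : exists i, m i != 0%N.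
  apply: contrapT => H; apply: m0; apply/mnmP => i; rewrite mnm0E.
  by apply/esym/eqP/negPn/negP => h; apply: H; exists i.
have := congr1 (mcoeff (mnm_sub m (mnm1 i))) (dp i).
rewrite mcoeff_mderiv mcoeff0 submK; last first.
  by apply/mnm_lepP => j; rewrite mnm1E; case: eqP => // <-; rewrite lt0n.
by move=> /eqP; rewrite mulrn_eq0 /= => /eqP.
Qed.

(** Induction on the degree: along each axis the restriction vanishes on an interval, so every
    partial derivative vanishes on the box and is zero by induction. The remaining constant is
    evaluated at the centre of the box. *)
Lemma meval_eq0_box p (a b : 'I_n -> R) : (forall i, a i < b i) ->
  (forall v, (forall i, a i < v i < b i) -> meval v p = 0) -> p = 0.
Proof.
move=> ab; have [k] := ubnP (mmeasure mdeg p); elim: k p => // k IH p hk hp.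
have [//|p0] := eqVneq p 0.
have {}IH i : d_ i p = 0.
  apply: IH.
    case: k hk => [|k] hk; last exact: msize_mderiv.
    by move: hk; rewrite ltnS leqn0 msize_poly_eq0 (negbTE p0).
  move=> v hv; have [g hg] := mpoly_line p v (fun j => (j == i)%:R).
  have /andP[av vb] := hv i.
  have g0 : g = 0.
    apply: (@poly_eq0_itv g (a i - v i) (b i - v i)) => [|t ht].
      by rewrite ltrD2r.
    rewrite (hg t).1; apply: hp => j; case: eqP => [->|_]; last by rewrite mulr0 addr0.
    by move: ht => /andP[h1 h2]; rewrite /= mulr1; apply/andP; split; lra.
  have := (hg 0).2; rewrite g0 derivC horner0 (bigD1 i) //= eqxx mul1r big1.
    rewrite addr0 => /esym <-; apply: meval_eq => j; by rewrite mul0r addr0.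
  by move=> j ji; rewrite (negbTE ji) mul0r.
have pC := mderiv_eq0_const IH.
have := hp (fun i => (a i + b i) / 2); rewrite pC mevalC => ->.
  by rewrite mpolyC0.
by move=> i; have := ab i; move=> h; apply/andP; split; lra.
Qed.

Lemma homogP N F :
  (forall m, mcoeff m F != 0 -> mdeg m = N) <-> F \is homog N.
Proof.
split=> [H|/dhomogP H m mF]; first by apply/dhomogP => m; rewrite mcoeff_msupp => /H.
by apply: H; rewrite mcoeff_msupp.
Qed.

Lemma homog_mderiv N F i : F \is homog N.+1 -> d_ i F \is homog N.
Proof.
move/homogP => H; apply/homogP => m; rewrite mcoeff_mderiv => h.
have /H : mcoeff (mnm_add m (mnm1 i)) F != 0.
  by apply: contraNneq h => ->; rewrite mul0rn.
by rewrite mdegD mdeg1 addn1 => -[].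
Qed.

Lemma homog0_mderiv F i : F \is homog 0 -> d_ i F = 0.
Proof.
move/homogP => H; apply/mpolyP => m; rewrite mcoeff_mderiv mcoeff0.
have [->|/H] := eqVneq (mcoeff (mnm_add m (mnm1 i)) F) 0; first exact: mul0rn.
by rewrite mdegD mdeg1 addn1.
Qed.

Lemma homog_XU i : (XU i : mpoly n R) \is homog 1.
Proof. by rewrite dhomogX; apply/eqP; exact: mdeg1. Qed.

Lemma homog_XUM N F i : F \is homog N -> XU i * F \is homog N.+1.
Proof. by move=> h; have := dhomogM (homog_XU i) h; rewrite add1n. Qed.

Lemma homog_XUd N F i j : F \is homog N -> XU i * d_ j F \is homog N.
Proof.
case: N => [|N] h; last by apply: homog_XUM; apply: homog_mderiv.
by rewrite homog0_mderiv // mulr0 dhomog0.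
Qed.

Lemma homog_rho N G e i r : G \is homog N -> rho e i r G \is homog N.+1.
Proof.
move=> h; rewrite /rho !mul_mpolyC mulrBr dhomogD //.
  by rewrite dhomogD ?dhomogN // ?dhomogZ ?homog_XUM.
by rewrite dhomogD ?dhomogN // mulrC;
  [rewrite mulrC -mulrA|rewrite mulrC (mulrC (XU i)) -mulrA];
  rewrite homog_XUM ?homog_XUd.
Qed.

Lemma euler N F : F \is homog N -> \sum_i XU i * d_ i F = N%:R * F.
Proof.
move/homogP => H; apply/mpolyP => m.
rewrite raddf_sum /= mulr_natl mcoeffMn.
have xe i : mcoeff m (XU i * d_ i F) = mcoeff m F *+ m i.
  have [mi|mi] := posnP (m i).
    rewrite mi mulr0n; apply/eqP; rewrite mcoeff_eq0 mulrC.
    rewrite (perm_mem (msuppMX _ _)); apply/negP => /mapP[k _ E].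
    by move: mi; rewrite E mnmDE mnm1E eqxx.
  have E : mnm_add (mnm_sub m (mnm1 i)) (mnm1 i) = m.
    by rewrite submK //; apply/mnm_lepP => j; rewrite mnm1E; case: eqP => // <-.
  rewrite -{1}E mulrC addmC mcoeffMX mcoeff_mderiv E.
  by rewrite mnmBE mnm1E eqxx subn1 prednK.
under eq_bigr do rewrite xe.
rewrite sumrMnr -mdegE; have [->|/H ->//] := eqVneq (mcoeff m F) 0.
by rewrite !mul0rn.
Qed.

Lemma meval_homog N F v t : F \is homog N ->
  meval (fun i => t * v i) F = t ^+ N * meval v F.
Proof.
move/dhomogP => H; rewrite !mevalE big_distrr /=.
rewrite big_seq [RHS]big_seq; apply: eq_bigr => m /H <-.
rewrite mulrCA; congr (_ * _); rewrite /= mdegE -prodrXr -big_split /=.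
by apply: eq_bigr => i _; rewrite exprMn.
Qed.

Definition kill r : mpoly n R -> mpoly n R :=
  comp_mpoly [tuple (if i == r then 0 else XU i) | i < n].

Lemma killXU r i : kill r (XU i) = if i == r then 0 else XU i.
Proof. by rewrite /kill comp_mpolyXU -tnth_nth tnth_mktuple. Qed.

Lemma kill_decomp r F : exists G, F = kill r F + XU r * G.
Proof.
elim/mpoly_mulind: F => [c|F F' [G E] [G' E']|i F [G E]].
- by exists 0; rewrite /kill comp_mpolyC mulr0 addr0.
- by exists (G + G'); rewrite {1}E {1}E' /kill rmorphD /=; ring.
rewrite /kill rmorphM /= -!/(kill _ _) killXU.
have [->|ir] := eqVneq i r; first by exists F; rewrite mul0r add0r.
by exists (XU i * G); rewrite {1}E; ring.
Qed.

Lemma homog_divX N F G r : F = XU r * G -> F \is homog N.+1 -> G \is homog N.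
Proof.
move=> E /homogP H; apply/homogP => m hm.
have /H : mcoeff (mnm_add (mnm1 r) m) F != 0 by rewrite E mulrC mcoeffMX.
by rewrite mdegD mdeg1 => -[].
Qed.

Lemma homog_divX0 F G r : F = XU r * G -> F \is homog 0 -> G = 0.
Proof.
move=> E /homogP H; apply/mpolyP => m; rewrite mcoeff0; apply/eqP.
apply/negPn/negP => hm.
have /H : mcoeff (mnm_add (mnm1 r) m) F != 0 by rewrite E mulrC mcoeffMX.
by rewrite mdegD mdeg1.
Qed.

End Structure.

(* Euler's relations for a homogeneous function of degree [N], its first
   derivatives [a], [am] and its second derivatives [b], [bm], [bmm], on the
   hyperplane where the coordinates [y], [ym] add up to 1. *)
Lemma euler_hyperplane (A : comNzRingType) d (y a : 'I_d -> A) (b : 'I_d -> 'I_d -> A)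
    (bm c : 'I_d -> A) (ym am bmm K N f : A) :
  (forall i j, b i j = b j i) ->
  \sum_i y i = 1 - ym ->
  \sum_i y i * a i = N * f - ym * am ->
  (forall i, \sum_j y j * b j i = (N - 1) * a i - ym * bm i) ->
  \sum_j y j * bm j = (N - 1) * am - ym * bmm ->
  \sum_i y i * (1 - y i) * (b i i - bm i - bm i + bmm)
  - 2%:R * (\sum_(i < d) \sum_(j < d | (i < j)%N)
             y i * y j * (b i j - bm i - bm j + bmm))
  + \sum_i (c i - K * y i) * (a i - am) =
  \sum_i (y i * b i i + c i * a i) + ym * bmm + (K - \sum_i c i) * am
  - (N * (N - 1) + K * N) * f.
Proof.
move=> bC sy ey ea em.
set S2 := \sum_(i < d) \sum_(j < d | _) _.
pose s i j := y i * y j * (b i j - bm i - bm j + bmm).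
(* Euler's relations only know full sums, so the sum over [i < j] is rewritten as half of the full
   square minus its diagonal. *)
have S2E : 2%:R * S2 = \sum_(i < d) \sum_(j < d) s i j - \sum_(i < d) s i i.
  have E1 : \sum_(i < d) \sum_(j < d) s i j =
      S2 + \sum_(i < d) \sum_(j < d | (j < i)%N) s i j + \sum_(i < d) s i i.
    rewrite -!big_split; apply: eq_bigr => i _ /=.
    rewrite (bigID (fun j : 'I_d => (i < j)%N)) /= -addrA; congr (_ + _).
    rewrite (bigD1 i) ?ltnn //= addrC; congr (_ + _); apply: eq_bigl => j.
    by rewrite -leqNgt ltn_neqAle andbC.
  have E2 : \sum_(i < d) \sum_(j < d | (j < i)%N) s i j = S2.
    rewrite (exchange_big_dep predT) //=; apply: eq_bigr => i _.
    by apply: eq_bigr => j _; rewrite /s (bC j); ring.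
  by rewrite E1 E2; ring.
have E3 : \sum_(i < d) \sum_(j < d) s i j =
    (N - 1) * (N * f - ym * am) - ym * ((N - 1) * am - ym * bmm)
    - 2%:R * (1 - ym) * ((N - 1) * am - ym * bmm) + (1 - ym) ^+ 2 * bmm.
  transitivity (\sum_(i < d) ((N - 1) * (y i * a i) - 1 * (y i * bm i)
      + ((1 - ym) * bmm - ((N - 1) * am - ym * bmm)) * y i)).
    apply: eq_bigr => i _.
    transitivity (\sum_(j < d) (y i * (y j * b j i) - y i * bm i * y j
        - y i * (y j * bm j) + y i * bmm * y j)).
      by apply: eq_bigr => j _; rewrite /s (bC j i); ring.
    rewrite !(sumrB, big_split) /= -!mulr_sumr ea em sy.
    by ring.
  by rewrite !(sumrB, big_split) /= -!mulr_sumr ey em sy; ring.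
rewrite S2E E3.
have -> : \sum_i y i * (1 - y i) * (b i i - bm i - bm i + bmm) =
    \sum_i y i * b i i - 2%:R * ((N - 1) * am - ym * bmm) + (1 - ym) * bmm
    - \sum_(i < d) s i i.
  transitivity (\sum_(i < d) (y i * b i i - 2%:R * (y i * bm i) + bmm * y i - s i i)).
    by apply: eq_bigr => i _ /=; rewrite /s; ring.
  by rewrite !(sumrB, big_split) /= -!mulr_sumr em sy; ring.
have -> : \sum_i (c i - K * y i) * (a i - am) =
    \sum_i c i * a i - (\sum_i c i) * am - K * (N * f - ym * am) + K * ((1 - ym) * am).
  rewrite -ey -sy.
  transitivity (\sum_(i < d) (c i * a i - c i * am - K * (y i * a i)
      + K * (y i * am))).
    by apply: eq_bigr => i _ /=; ring.
  by rewrite !(sumrB, big_split) /= -!mulr_sumr -!mulr_suml; ring.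
by rewrite big_split /=; ring.
Qed.

(** * Dehomogenization *)

Section Dehomogenization.
Variables (R : realType) (d : nat).
Implicit Types (F G : mpoly d.+1 R) (e : 'I_d.+1 -> R).
Local Notation wid := (widen_ord (leqnSn d)).

Definition phi F : mpoly d R := comp_mpoly [tuple Xp R i | i < d.+1] F.

Lemma phiD F G : phi (F + G) = phi F + phi G. Proof. exact: rmorphD. Qed.
Lemma phiB F G : phi (F - G) = phi F - phi G. Proof. exact: rmorphB. Qed.
Lemma phiM F G : phi (F * G) = phi F * phi G. Proof. exact: rmorphM. Qed.
Lemma phiC c : phi (C c) = C c. Proof. exact: comp_mpolyC. Qed.
Lemma phiZ c F : phi (c *: F) = c *: phi F. Proof. exact: comp_mpolyZ. Qed.
Lemma phi0 : phi 0 = 0. Proof. exact: rmorph0. Qed.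
Lemma phi1 : phi 1 = 1. Proof. exact: rmorph1. Qed.
Lemma phi_nat k : phi k%:R = k%:R. Proof. exact: rmorph_nat. Qed.
Lemma phi_sum (I : Type) (r : seq I) (P : pred I) (F : I -> mpoly d.+1 R) :
  phi (\sum_(i <- r | P i) F i) = \sum_(i <- r | P i) phi (F i).
Proof. exact: rmorph_sum. Qed.

Lemma phiXU i : phi (XU i) = Xp R i.
Proof. by rewrite /phi comp_mpolyXU -tnth_nth tnth_mktuple. Qed.

Lemma Xp_widen (j : 'I_d) : Xp R (wid j) = Xv R j.
Proof. by rewrite /Xp /= (valK j). Qed.

Lemma Xp_max : Xp R (@ord_max d) = 1 - \sum_(j < d) Xv R j.
Proof. by rewrite /Xp /= insubF // ltnn. Qed.

Lemma xc_widen (x : 'rV[R]_d) (j : 'I_d) : xc x (wid j) = x ord0 j.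
Proof. by rewrite /xc /= (valK j). Qed.

Lemma xc_max (x : 'rV[R]_d) : xc x ord_max = 1 - \sum_(j < d) x ord0 j.
Proof. by rewrite /xc /= insubF // ltnn. Qed.

Lemma ord_max_or_widen (i : 'I_d.+1) : i = ord_max \/ exists j, i = wid j.
Proof.
have [E|ne] := eqVneq i ord_max; [by left|right].
have lt : (i < d)%N.
  by rewrite ltn_neqAle -ltnS ltn_ord andbT; apply: contraNneq ne => E; apply/eqP/val_inj.
by exists (Ordinal lt); apply: val_inj.
Qed.

Lemma sum_wid (V : nmodType) (f : 'I_d.+1 -> V) :
  \sum_i f i = \sum_(j < d) f (wid j) + f ord_max.
Proof.
by rewrite big_ord_recr; congr (_ + _); apply: eq_bigr => j _; congr f; apply: val_inj.
Qed.

Lemma ev_Xp (x : 'rV[R]_d) (i : 'I_d.+1) : ev (Xp R i) x = xc x i :> R.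
Proof.
have [->|[j ->]] := ord_max_or_widen i.
  rewrite Xp_max xc_max /ev mevalB meval1 (raddf_sum (meval _)); congr (1 - _).
  by apply: eq_bigr => j _; exact: mevalXU.
by rewrite Xp_widen xc_widen /ev mevalXU.
Qed.

Lemma ev_phi F (x : 'rV[R]_d) : ev (phi F) x = meval (xc x) F.
Proof.
rewrite /ev /phi comp_mpoly_meval; apply: meval_eq => i.
by rewrite tnth_mktuple -/(ev _ x) ev_Xp.
Qed.

Lemma pd_phi j F : pd j (phi F) = phi (d_ (wid j) F - d_ ord_max F).
Proof.
elim/mpoly_mulind: F => [c|F G hF hG|i F hF].
- by rewrite phiC /pd !mderivC subrr phi0.
- rewrite (phiD F G) /pd (mderivD j (phi F) (phi G)) -!/(pd j _) hF hG -phiD.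
  by rewrite !(mderivD _ F G); congr phi; ring.
rewrite phiM phiXU /pd mderivM -!/(pd j _) hF !mderivM !mderivXU.
rewrite !(phiB, phiD, phiM) phiXU.
have -> : pd j (Xp R i) = phi (wid j == i)%:R - phi (ord_max == i)%:R.
  rewrite /phi !rmorph_nat.
  have [->|[k ->]] := ord_max_or_widen i.
    rewrite eqxx (_ : (_ == _) = false) ?sub0r; last first.
      by apply/eqP => /(congr1 val) /= E; move: (ltn_ord j); rewrite E ltnn.
    rewrite Xp_max /pd mderivB (raddf_sum (mderiv j)) (bigD1 j) //= big1.
      by rewrite (mderivXU R j j) eqxx addr0 -mpolyC1 mderivC sub0r.
    by move=> k kj; rewrite (mderivXU R j k) eq_sym (negbTE kj).
  rewrite Xp_widen /pd (mderivXU R j k).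
  rewrite (_ : (ord_max == _) = false) ?subr0 //.
  by apply/eqP => /(congr1 val) /= E; move: (ltn_ord k); rewrite -E ltnn.
by ring.
Qed.

Lemma Lop_phi N e F : F \is homog N ->
  Lop e (phi F) =
  phi (lap e F) - (N%:R * (N%:R + \sum_i e i + d%:R)) *: phi F.
Proof.
move=> hF; pose m := @ord_max d.
pose y (i : 'I_d.+1) := phi (XU i); pose a i := phi (d_ i F).
pose b i j := phi (d_ i (d_ j F)).
have bC i j : b i j = b j i by rewrite /b mderiv_comm.
have sy : \sum_(i < d) y (wid i) = 1 - y m.
  rewrite /y phiXU Xp_max opprB addrC subrK; apply: eq_bigr => i _.
  by rewrite phiXU Xp_widen.
have ey : \sum_(i < d) y (wid i) * a (wid i) = N%:R * phi F - y m * a m.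
  have := congr1 phi (euler hF); rewrite phi_sum sum_wid /= !phiM.
  rewrite phi_nat => <-.
  by rewrite addrK; apply: eq_bigr => i _; rewrite phiM.
have ea i : \sum_(j < d) y (wid j) * b (wid j) i = (N%:R - 1) * a i - y m * b m i.
  (* For [N = 0] the factor [N - 1] is -1 in the ring; the relation still holds because all
     derivatives of a form of degree 0 vanish. *)
  case: N hF ey => [|N] hF _.
    rewrite /a /b homog0_mderiv // !mderiv0 phi0 !mulr0 subrr big1 // => j _.
    by rewrite mderiv0 phi0 mulr0.
  have := congr1 phi (euler (homog_mderiv i hF)); rewrite phi_sum sum_wid /= !phiM.
  rewrite phi_nat -natr1 addrK => <-.
  by rewrite addrK; apply: eq_bigr => j _; rewrite phiM.
have p2 i j : pd i (pd j (phi F)) =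
    b (wid i) (wid j) - b m (wid i) - b m (wid j) + b m m.
  by rewrite !pd_phi !(phiB, mderivB) -!/(b _ _) (bC (wid i) m);
    move: (b _ _) (b _ _) (b _ _) (b _ _) => *; ring.
have KE : C (\sum_l e l + d.+1%:R) = C (\sum_i e i + d%:R) + 1 :> mpoly d R.
  by rewrite -natr1 addrA mpolyCD mpolyC1.
(* Removing the first [d] constants [e_i + 1] from [|e| + d + 1] leaves the constant of the
   eliminated variable, which completes [lap e F]. *)
have cm : C (\sum_i e i + d%:R) + 1 - \sum_(i < d) C (e (wid i) + 1)
    = C (e m + 1) :> mpoly d R.
  rewrite -raddf_sum big_split /= sumr_const card_ord sum_wid -/m.
  by rewrite -mpolyC1 -mpolyCD -mpolyCB; congr mpolyC; ring.
have := @euler_hyperplane _ d (y \o wid) (a \o wid) (fun i j => b (wid i) (wid j))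
  (fun i => b m (wid i)) (fun i => C (e (wid i) + 1)) (y m) (a m) (b m m)
  (C (\sum_i e i + d%:R) + 1) N%:R (phi F) (fun i j => bC _ _) sy ey
  (fun i => ea (wid i)).
under eq_bigr do rewrite /= (bC m).
move=> /(_ (ea m)) /=.
rewrite cm => E.
have -> : phi (lap e F) = \sum_(i < d) (y (wid i) * b (wid i) (wid i)
    + C (e (wid i) + 1) * a (wid i)) + y m * b m m + C (e m + 1) * a m.
  rewrite /lap phi_sum sum_wid -addrA /= phiD !phiM phiC; congr (_ + _).
  by apply: eq_bigr => j _; rewrite phiD !phiM phiC.
have -> : (N%:R * (N%:R + \sum_i e i + d%:R)) *: phi F =
    (N%:R * (N%:R - 1) + (C (\sum_i e i + d%:R) + 1) * N%:R) * phi F.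
  rewrite -mul_mpolyC mpolyCM -addrA mpolyCD !mpolyC_nat; congr (_ * _).
  by move: (C _) => k; ring.
rewrite -E /Lop /Defs.cst (mpolyC_nat _ _ 2); congr (_ - _ * _ + _).
- by apply: eq_bigr => i _; rewrite p2 -Xp_widen -phiXU (bC m).
- apply: eq_bigr => i _; apply: eq_bigr => j _.
  by rewrite p2 -!Xp_widen -!phiXU (bC m (wid i)) (bC m (wid j)).
- apply: eq_bigr => i _.
  by rewrite pd_phi phiB -Xp_widen -phiXU KE.
Qed.

End Dehomogenization.

(** * Dehomogenization is a bijection in each degree *)

Section Lift.
Variables (R : realType) (d : nat).
Implicit Types (F G : mpoly d.+1 R) (p : mpoly d R).
Local Notation wid := (widen_ord (leqnSn d)).

(** Every point of the positive orthant is a multiple [s x] of a point whose coordinates add up to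
    1, and a form takes there [s ^+ N] times its value at [x]. *)
Lemma phi_inj N F : F \is homog N -> phi F = 0 -> F = 0.
Proof.
move=> hF F0; apply: (@meval_eq0_box _ _ F (fun=> 0) (fun=> 1)) => [_|v hv].
  exact: ltr01.
pose s := \sum_i v i.
have s0 : 0 < s.
  rewrite /s (bigD1 ord0) //= ltr_pwDl //; first by have /andP[] := hv ord0.
  by apply: sumr_ge0 => i _; have /andP[/ltW] := hv i.
pose x : 'rV[R]_d := \row_j (v (wid j) / s).
have xE i : s * xc x i = v i.
  have xw j : s * xc x (wid j) = v (wid j).
    by rewrite xc_widen mxE mulrC divfK ?gt_eqF.
  have [->|[j ->]] := ord_max_or_widen i; last exact: xw.
  have -> : v ord_max = s - \sum_(j < d) v (wid j) by rewrite /s sum_wid addrC addKr.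
  rewrite xc_max mulrBr mulr1 mulr_sumr; congr (_ - _).
  by apply: eq_bigr => j _; rewrite -xc_widen.
rewrite -(meval_eq F xE) (meval_homog _ _ hF) -ev_phi F0.
by rewrite /ev meval0 mulr0.
Qed.

Lemma ev_interior_inj p : (forall x, Defs.interior x -> ev p x = 0) -> p = 0.
Proof.
(* The cube with side [1 / (d + 1)] at the origin lies in the simplex: its first [d] coordinates add
   up to at most [d / (d + 1) < 1]. *)
move=> hp; apply: (@meval_eq0_box _ _ p (fun=> 0) (fun=> d.+1%:R^-1)) => [_|v hv].
  by rewrite invr_gt0 ltr0n.
have := hp (\row_j v j); rewrite /ev => hx; rewrite -[RHS]hx.
  by apply: meval_eq => i; rewrite mxE.
move=> i /=; have [->|[j ->]] := ord_max_or_widen i; last first.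
  by rewrite xc_widen mxE; have /andP[] := hv j.
rewrite xc_max subr_gt0; apply: (@le_lt_trans _ _ (\sum_(j < d) d.+1%:R^-1)).
  by apply: ler_sum => j _; rewrite mxE; have /andP[_ /ltW] := hv j.
rewrite sumr_const card_ord -[ltLHS]mulr_natr mulrC ltr_pdivrMr ?ltr0n //.
by rewrite mul1r ltr_nat.
Qed.

Lemma homog_sum n N (I : Type) (r : seq I) (P : pred I) (F : I -> mpoly n R) :
  (forall i, P i -> F i \is homog N) -> \sum_(i <- r | P i) F i \is homog N.
Proof.
by move=> H; elim/big_ind: _ => // [|a b ha hb]; [exact: dhomog0|exact: dhomogD].
Qed.

(** Monomials of lower degree are filled up with powers of the sum of all variables, which [phi]
    sends to 1. *)
Lemma phi_lift N p : (mmeasure mdeg p <= N.+1)%N ->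
  exists2 F, F \is homog N & phi F = p.
Proof.
move=> hp; pose s : mpoly d.+1 R := \sum_i XU i.
exists (\sum_(m <- msupp p) mcoeff m p *: (mpolyX R (mnmwiden m) * s ^+ (N - mdeg m))).
  rewrite big_seq; apply: homog_sum => m /(mmeasure_mnm_lt mdeg) /= hm.
  apply: dhomogZ; have -> : N = (mdeg m + 1 * (N - mdeg m))%N.
    by rewrite mul1n subnKC // -ltnS (leq_trans hm).
  apply: dhomogM.
    rewrite dhomogX /= !mdegE big_ord_recr /= mnmwiden_ordmax addn0.
    by apply/eqP; apply: eq_bigr => i _; exact: mnmwiden_widen.
  rewrite mul1n addKn -[X in ishomog1 X _]mul1n.
  by apply: dhomogMn; apply: homog_sum => i _; apply: homog_XU.
rewrite phi_sum [RHS]mpolyE; apply: eq_bigr => m _; rewrite phiZ phiM.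
have -> : phi (s ^+ (N - mdeg m)) = 1.
  rewrite [LHS]rmorphXn /= -/(phi _) /s phi_sum sum_wid phiXU Xp_max.
  rewrite (eq_bigr (@Xv R d)) => [|j _]; last by rewrite phiXU Xp_widen.
  by rewrite subrKC expr1n.
rewrite mulr1; congr (_ *: _); rewrite /phi comp_mpolyX [RHS]mpolyXE_id.
rewrite big_ord_recr /= mnmwiden_ordmax expr0 mulr1; apply: eq_bigr => j _.
by rewrite tnth_mktuple mnmwiden_widen Xp_widen.
Qed.

Lemma msize_phi N F : F \is homog N -> (mmeasure mdeg (phi F) <= N.+1)%N.
Proof.
move/dhomogP => hF; rewrite [F]mpolyE phi_sum big_seq.
elim/big_ind: _ => [||m /hF /= <-]; first by rewrite mmeasure0.
  by move=> a b ha hb; apply: leq_trans (mmeasureD_le _ _ _) _; rewrite geq_max ha.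
rewrite phiZ; apply: leq_trans (mmeasureZ_le _ _ _) _.
rewrite /phi comp_mpolyX mdegE.
elim: (index_enum _) => [|i s IH]; first by rewrite !big_nil mmeasure1.
rewrite !big_cons tnth_mktuple.
elim: (m i) => [|k IHk]; first by rewrite expr0 mul1r add0n.
rewrite exprS -mulrA addSn.
set q := _ * _ in IHk *; rewrite -!/(mmeasure _ _) in IHk *.
have h : (mmeasure mdeg (Xp R i) <= 2)%N.
  have hX j : (mmeasure mdeg (Xv R j) <= 2)%N by rewrite mmeasureX /= mdeg1.
  have [->|[j ->]] := ord_max_or_widen i; last by rewrite Xp_widen.
  rewrite Xp_max; apply: leq_trans (mmeasureD_le _ _ _) _.
  rewrite geq_max mmeasure1 /= mmeasureN; elim/big_ind: _ => // [|a b ha hb].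
    by rewrite mmeasure0.
  by apply: leq_trans (mmeasureD_le _ _ _) _; rewrite geq_max ha.
have [->|q0] := eqVneq q 0; first by rewrite mulr0 mmeasure0.
have [->|X0] := eqVneq (Xp R i) 0; first by rewrite mul0r mmeasure0.
rewrite msizeM // -[X in (_ <= X)%N]/(2 + (_ + _).+1).-1.
by rewrite -!subn1 leq_sub2r // leq_add.
Qed.

End Lift.

(** * Rodrigues formula *)

Section Rodrigues.
Variables (R : realType) (n : nat) (r : 'I_n).
Implicit Types (st : ('I_n -> R) * mpoly n R) (s : seq 'I_n) (mm : 'I_n -> nat).

(* A state [(f, G)] stands for the function [X^f G]. *)
Definition rodrigues_step (i : 'I_n) st :=
  let f j := st.1 j - (j == i)%:R - (j == r)%:R in (f, rho f i r st.2).

Definition rodrigues s mm st := foldr (fun i => iter (mm i) (rodrigues_step i)) st s.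

(** Built by the same recursion as [rodrigues], so that a single induction, [rodrigues_ind], runs
    over both; [monoE] gives the exponents. *)
Definition mono s mm : multinom n :=
  foldr (fun i => iter (mm i) (fun a => mnm_add a (mnm1 i))) mnm0 s.

Lemma rodrigues_ind (P : multinom n -> _ -> Prop) s mm st : P mnm0 st ->
  (forall a st i, i \in s -> P a st -> P (mnm_add a (mnm1 i)) (rodrigues_step i st)) ->
  P (mono s mm) (rodrigues s mm st).
Proof.
move=> P0; elim: s => //= i s IH H.
have {}IH : P (mono s mm) (rodrigues s mm st).
  by apply: IH => a u j js; apply: H; rewrite inE js orbT.
by elim: (mm i) => //= k IHk; apply: H => //; rewrite mem_head.
Qed.

Lemma monoE s mm j : uniq s -> mono s mm j = if j \in s then mm j else 0%N.
Proof.
elim: s => [|i s IH] /=; first by rewrite mnm0E.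
move=> /andP[is_ us]; rewrite inE.
have -> : iter (mm i) (fun a => mnm_add a (mnm1 i)) (mono s mm) j
    = ((mono s mm) j + (j == i) * mm i)%N.
  elim: (mm i) => [|k IHk] /=; first by rewrite muln0 addn0.
  by rewrite mnmDE IHk mnm1E eq_sym -addnA mulnS (addnC (_ * _)%N).
rewrite IH //; have [->|ji] := eqVneq j i; first by rewrite (negbTE is_) mul1n.
by rewrite mul0n addn0.
Qed.

Lemma mdeg_mono s mm : mdeg (mono s mm) = (\sum_(i <- s) mm i)%N.
Proof.
elim: s => [|i s IH]; first by rewrite big_nil /= mdeg0.
rewrite big_cons /=; elim: (mm i) => [|k IHk] /=; first by rewrite IH.
by rewrite mdegD IHk mdeg1 addn1.
Qed.

Lemma lap_eq (e e' : 'I_n -> R) F : e =1 e' -> lap e F = lap e' F.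
Proof. by move=> E; apply: eq_bigr => i _; rewrite E. Qed.

(** The invariant of a partially applied Rodrigues formula, where [a] records the steps already
    made. The exponent at [r] drops with every step, so the guard [-1 < st.1 r] on the current state
    implies the same bound at all earlier steps, and thus that no factor of [c] vanishes. *)
Variant rodrigues_spec (A : {set 'I_n}) (f : 'I_n -> R)
  (a : multinom n) st : Prop :=
  RodriguesSpec of
    (forall j, st.1 j = f j - (a j)%:R - (j == r)%:R * (mdeg a)%:R)
  & lap st.1 st.2 = 0
  & (forall j, j != r -> j \notin A -> mderiv j st.2 = 0)
  & st.2 \is homog (mdeg a)
  & (exists2 c, -1 < st.1 r -> c != 0 & kill r st.2 = c *: mpolyX R a).

Lemma rodriguesP (A : {set 'I_n}) f s mm : {subset s <= A} -> r \notin A ->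
  rodrigues_spec A f (mono s mm) (rodrigues s mm (f, 1)).
Proof.
move=> sA rA; apply: rodrigues_ind => [|a st i /sA iA [E L D H [c c0 K]]].
  split=> //=.
  - by move=> j; rewrite mnm0E mdeg0 mulr0 !subr0.
  - by rewrite /lap big1 // => j _; rewrite -mpolyC1 !mderivC ?mderiv0 !mulr0 addr0.
  - by move=> j _ _; rewrite -mpolyC1 mderivC.
  - by rewrite mdeg0 dhomog1.
  exists 1; first by rewrite oner_eq0.
  by rewrite mpolyX0 scale1r /kill rmorph1.
have ir : i != r by apply: contraTneq iA => ->.
rewrite /rodrigues_step; set f' := fun j : 'I_n => _.
have f'E : bump2 f' i r =1 st.1 by move=> j; rewrite /bump2 /f' /=; ring.
split=> /=.
- move=> j; rewrite /f' E mdegD mdeg1 mnmDE mnm1E !natrD (eq_sym i j); ring.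
- rewrite lap_rho // (lap_eq _ f'E) L /rho !mderiv0 !mulr0 !subrr mulr0.
  by rewrite addr0.
- move=> j jr jA; have ji : j != i by apply: contraNneq jA => ->.
  have dj := D j jr jA.
  rewrite /rho !(mderivD, mderivB, mderivN, mderivM, mderivC, mderivXU).
  rewrite (mderiv_comm i j) (mderiv_comm r j) dj !mderiv0.
  rewrite (negbTE jr) (negbTE ji) (_ : false%:R = 0 :> mpoly n R) //; ring.
- by rewrite mdegD mdeg1 addn1; apply: homog_rho.
(* Modulo [X_r] only the term [-(f' r + 1) X_i G] of [rho] survives. *)
exists (- (f' r + 1) * c).
  move=> h; rewrite mulf_neq0 //; first by rewrite oppr_eq0 gt_eqF // -ltrBlDr sub0r.
  apply: c0; rewrite (lt_trans h) // /f' eqxx eq_sym (negbTE ir) subr0.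
  by rewrite ltrBlDr ltrDl ltr01.
have kM p q : kill r (p * q) = kill r p * kill r q :> mpoly n R := rmorphM _ p q.
have kC x : kill r (C x) = C x :> mpoly n R := comp_mpolyC x _.
have kD p q : kill r (p + q) = kill r p + kill r q :> mpoly n R := rmorphD _ p q.
have kB p q : kill r (p - q) = kill r p - kill r q :> mpoly n R := rmorphB _ p q.
rewrite /rho kD kB !kM !killXU !kC eqxx (negbTE ir) K !(mul0r, mulr0) sub0r addr0.
by rewrite mpolyXD -!mul_mpolyC mpolyCM mpolyCN; ring.
Qed.

End Rodrigues.

(** * The Rodrigues step on functions with real exponents *)

Section RodriguesAnalytic.
Variables (R : realType) (d : nat).
Implicit Types (S T : {set 'I_d.+1}) (f : 'I_d.+1 -> R) (G : mpoly d.+1 R).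
Implicit Types (x : 'rV[R]_d) (h : 'rV[R]_d -> R).
Local Notation wid := (widen_ord (leqnSn d)).
Local Notation evec := (@evec R d).

Lemma evecE i (j : 'I_d) : evec i ord0 j = (i == wid j)%:R.
Proof.
rewrite /Defs.evec; have [->|[k ->]] := ord_max_or_widen i.
  rewrite /= insubF ?ltnn //= mxE (_ : _ == _ = false) //.
  by apply/eqP => /(congr1 val) /= E; move: (ltn_ord j); rewrite -E ltnn.
rewrite /= (valK k) /= mxE eqxx /= eq_sym; congr (_%:R).
Qed.

Lemma xc_line x t i r j :
  xc (t *: (evec i - evec r) + x) j = xc x j + t * ((i == j)%:R - (r == j)%:R).
Proof.
have [->|[k ->]] := ord_max_or_widen j; last first.
  by rewrite !xc_widen !mxE !evecE addrC.
have se k : \sum_(j < d) (k == wid j)%:R = 1 - (k == ord_max)%:R :> R.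
  have := sum_wid (fun l => (k == l)%:R : R).
  rewrite (bigD1 k) //= eqxx big1 ?addr0 => [E|l lk].
    by apply/eqP; rewrite eq_sym subr_eq -E.
  by rewrite eq_sym (negbTE lk).
rewrite !xc_max; under eq_bigr do rewrite !mxE !evecE.
rewrite big_split -mulr_sumr sumrB !se /=; ring.
Qed.

Definition weight T f x : R := \prod_(j in T) (xc x j) `^ (f j).

Lemma Dop_lineE S i h x :
  Dop S i h x = derive1 (fun t : R => h (t *: (evec i - evec (rS S)) + x)) 0.
Proof.
rewrite /Dop /derive /derive1.
set F := (X in lim (fmap X _)); set F' := (X in _ = lim (fmap X _)).
suff -> : F = F' by [].
by apply/funext => t; rewrite /F /F' /shift /= addr0 scale0r add0r.
Qed.

(** Moving along [e_i - e_r] changes just two coordinates, [x_i] by [t] and [x_r] by [-t]; the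
    product rule for these two powers and the polynomial then yields exactly [rho] at the lowered
    exponents. *)
Lemma Dop_weight S T i f G h x :
  i \in T -> rS S \in T -> i != rS S -> Defs.interior x ->
  (forall y, Defs.interior y -> h y = weight T f y * ev (phi G) y) ->
  let st := rodrigues_step (rS S) i (f, G) in
  Dop S i h x = weight T st.1 x * ev (phi st.2) x.
Proof.
move=> iT rT ir ix hE /=; rewrite Dop_lineE; set r := rS S in rT ir *.
have ri : r != i by rewrite eq_sym.
pose f' j := f j - (j == i)%:R - (j == r)%:R.
rewrite -/f'.
pose K := \prod_(j in T | (j != i) && (j != r)) xc x j `^ f j.
have wE (g : 'I_d.+1 -> R) (y : 'rV[R]_d) : weight T g y = xc y i `^ g i *
    (xc y r `^ g r * \prod_(j in T | (j != i) && (j != r)) xc y j `^ g j).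
  rewrite /weight (bigD1 i) // (bigD1 r) /=; last by rewrite rT.
  by congr (_ * (_ * _)); apply: eq_bigl => j; rewrite andbA.
have [g hg] := mpoly_line G (xc x) (fun j => (i == j)%:R - (r == j)%:R).
pose k t := (xc x i + t) `^ f i * ((xc x r - t) `^ f r * (K * g.[t])).
have xi : 0 < xc x i := ix i.
have xr : 0 < xc x r := ix r.
(* [h] is known only in the interior, so it is replaced by the explicit product for those small [t]
   that keep the coordinates [i] and [r] positive. *)
have near_k : \forall t \near 0, k t = h (t *: (evec i - evec r) + x).
  have t1 : \forall t \near (0 : R), - xc x i < t by apply: lt_nbhsr; rewrite oppr_lt0.
  have t2 : \forall t \near (0 : R), t < xc x r by exact: lt_nbhsl.
  near=> t; rewrite hE; last first.
    have h1 : - xc x i < t by near: t.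
    have h2 : t < xc x r by near: t.
    move=> j; rewrite xc_line; have [->|ji] := eqVneq j i.
      by rewrite (negbTE ri) subr0 mulr1; lra.
    have [->|jr] := eqVneq j r; first by rewrite sub0r mulrN1 subr_gt0.
    by rewrite subrr mulr0 addr0; exact: ix.
  rewrite wE !xc_line !eqxx (negbTE ir) (negbTE ri) subr0 mulr1 sub0r mulrN1.
  rewrite ev_phi /k (hg t).1 -!mulrA; congr (_ * (_ * (_ * _))).
    apply: eq_bigr => j /andP[_ /andP[ji jr]].
    by rewrite xc_line eq_sym (negbTE ji) eq_sym (negbTE jr) subrr mulr0 addr0.
  by apply: meval_eq => j; rewrite xc_line.
rewrite derive1E -(near_eq_derive _ near_k).
have dki : is_derive (0 : R) 1 (fun t : R => (xc x i + t) `^ f i)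
    (f i * xc x i `^ (f i - 1)).
  have h0 : 0 < xc x i + 0 by rewrite addr0.
  have := @is_derive1_comp _ (fun y : R => y `^ f i) (fun t => xc x i + t) 0 _ 1
    (is_derive1_powR _ h0).
  rewrite addr0 mulr1; apply.
  by rewrite -[X in is_derive _ _ _ X]add0r; apply: is_deriveD.
have dkr : is_derive (0 : R) 1 (fun t : R => (xc x r - t) `^ f r)
    (- (f r * xc x r `^ (f r - 1))).
  have h0 : 0 < xc x r - 0 by rewrite subr0.
  have := @is_derive1_comp _ (fun y : R => y `^ f r) (fun t => xc x r - t) 0 _ (-1)
    (is_derive1_powR _ h0).
  rewrite subr0 mulrN1; apply.
  by rewrite -[X in is_derive _ _ _ X]add0r; apply: is_deriveD.
have dg : is_derive (0 : R) 1 (fun t => K * g.[t]) (K * (g^`()).[0]).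
  exact: (@is_deriveZ _ _ _ (horner g) K 0 1 _ (is_derive_poly g 0)).
have dk := is_deriveM dki (is_deriveM dkr dg).
rewrite [LHS](@derive_val _ _ _ _ _ _ _ dk).
transitivity ((xc x i + 0) `^ f i * ((xc x r - 0) `^ f r * (K * (g^`()).[0])
    + (K * g.[0]) * - (f r * xc x r `^ (f r - 1)))
    + ((xc x r - 0) `^ f r * (K * g.[0])) * (f i * xc x i `^ (f i - 1))).
  by [].
(* Splitting one factor off each of the two powers makes [x_i] and [x_r] appear as in [rho] and
   leaves the exponents lowered by one. *)
have pR (y a : R) : 0 < y -> y `^ a = y * y `^ (a - 1).
  move=> y0; rewrite -{2}[y]powRr1 ?ltW // -powRD ?subrKC //.
  by rewrite (gt_eqF y0) implybT.
rewrite wE /f' !eqxx (negbTE ir) (negbTE ri) !subr0.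
have -> : \prod_(j in T | (j != i) && (j != r))
    xc x j `^ (f j - (j == i)%:R - (j == r)%:R) = K.
  by apply: eq_bigr => j /andP[_ /andP[/negbTE -> /negbTE ->]]; rewrite !subr0.
have := hg 0; set w := fun j => _; case=> g0 dg0.
have wx : w =1 xc x by move=> j; rewrite /w mul0r addr0.
rewrite (meval_eq _ wx) in g0.
have {}dg0 : (g^`()).[0] = meval (xc x) (mderiv i G) - meval (xc x) (mderiv r G).
  rewrite dg0; under eq_bigr do rewrite (meval_eq _ wx) mulrBl.
  rewrite sumrB; congr (_ - _).
    rewrite (bigD1 i) //= eqxx mul1r big1 ?addr0 // => j ji.
    by rewrite eq_sym (negbTE ji) mul0r.
  rewrite (bigD1 r) //= eqxx mul1r big1 ?addr0 // => j ji.
  by rewrite eq_sym (negbTE ji) mul0r.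
rewrite ev_phi /rho mevalD mevalB !mevalM mevalB !mevalC !mevalXU.
rewrite !eqxx (negbTE ir) (negbTE ri) !subr0 !subrK g0 dg0.
rewrite addr0 ?subr0 (pR _ (f i) xi) (pR _ (f r) xr) (_ : true%:R = 1 :> R) //.
ring.
Unshelve. all: by end_near. Qed.

End RodriguesAnalytic.

(** * Dimension of a span and the number of multi-indices *)

Section Dimension.
Variables (R : realType) (d : nat).

Lemma has_dim_ext (U V : Defs.space R d) N :
  (forall p, U p <-> V p) -> has_dim U N -> has_dim V N.
Proof.
move=> UV [b [bU bf bs]]; exists b; split=> // [i|p /UV /bs //].
exact/UV.
Qed.

Lemma has_dim_span (I : finType) (P : pred I) (v : I -> mpoly d R) :
  (forall c : I -> R, \sum_(i | P i) c i *: v i = 0 -> forall i, P i -> c i = 0) ->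
  has_dim (fun p => exists c : I -> R, p = \sum_(i | P i) c i *: v i) #|P|.
Proof.
move=> vf; have sE (f : I -> mpoly d R) :
    \sum_(i < #|P|) f (enum_val i) = \sum_(i | P i) f i.
  by rewrite -(big_enum_val f).
exists (fun k => v (enum_val k)); split.
- move=> k; exists (fun i => (i == enum_val k)%:R).
  rewrite (bigD1 (enum_val k)) /=; last exact: (enum_valP k).
  rewrite eqxx scale1r big1 ?addr0 // => i /andP[_ /negbTE ->].
  by rewrite scale0r.
(* [c'] extends [c] to all of [I]; the sum has at most one term and spares a default index. *)
- move=> c c0 k; pose c' i := \sum_(l | enum_val l == i) c l.
  have c'E j : c' (enum_val j) = c j.
    by rewrite /c' (big_pred1 j) // => l; rewrite (inj_eq enum_val_inj).
  rewrite -c'E; apply: vf (enum_valP k).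
  by rewrite -sE -[RHS]c0; apply: eq_bigr => j _; rewrite c'E.
- move=> p [c ->]; exists (fun k => c (enum_val k)).
  by rewrite (sE (fun i => c i *: v i)).
Qed.

(** Stars and bars, carried over from tuples. Since the functions vanish outside [A], enumerating
    their values on [A] loses nothing. *)
Lemma card_compositions (T : finType) (A : {set T}) m : (0 < #|A|)%N ->
  #|[pred mm : {ffun T -> 'I_m.+1} | ((\sum_(i in A) (mm i : nat))%N == m) &&
       [forall i, (i \notin A) ==> ((mm i : nat) == 0%N)]]| = 'C(m + #|A| - 1, m).
Proof.
move=> A0; have [k Ak] : exists k, #|A| = k.+1 by exists #|A|.-1; rewrite prednK.
have sE (f : T -> nat) : (\sum_(i < k.+1) f (enum_val (cast_ord (esym Ak) i)))%N
    = (\sum_(i in A) f i)%N.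
  rewrite (big_enum_val f) (reindex (cast_ord Ak)) /=; last first.
    by exists (cast_ord (esym Ak)) => i _; rewrite ?cast_ordK ?cast_ordKV.
  by apply: eq_bigr => i _; rewrite cast_ordK.
rewrite Ak addnS subn1 /= -[in RHS](addnK k m) -bin_sub ?leq_addr // addnK.
rewrite addnC addnC -[X in 'C(X, _)]addnC addKn.
have := card_ord_partitions k m => <-.
pose h (mm : {ffun T -> 'I_m.+1}) : k.+1.-tuple 'I_m.+1 :=
  [tuple mm (enum_val (cast_ord (esym Ak) i)) | i < k.+1].
rewrite -(card_in_imset (f := h)); last first.
  move=> a b; rewrite !inE => /andP[_ /forallP a0] /andP[_ /forallP b0] ab.
  apply/ffunP => i; have [iA|iA] := boolP (i \in A); last first.
    have /implyP/(_ iA)/eqP ai := a0 i; have /implyP/(_ iA)/eqP bi := b0 i.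
    by apply: val_inj; rewrite /= ai bi.
  have := congr1 (fun t => tnth t (cast_ord Ak (enum_rank_in iA i))) ab.
  by rewrite !tnth_mktuple cast_ordK enum_rankK_in.
apply: eq_card => t; rewrite inE; apply/imsetP/eqP => [[mm]|tm].
  rewrite inE => /andP[/eqP sm _] ->; rewrite -[RHS]sm -sE big_tuple.
  by apply: eq_bigr => i _; rewrite tnth_mktuple.
have [i0 i0A] := card_gt0P A0.
pose mm : {ffun T -> 'I_m.+1} :=
  [ffun i => if i \in A then tnth t (cast_ord Ak (enum_rank_in i0A i)) else ord0].
have mmE i : mm (enum_val (cast_ord (esym Ak) i)) = tnth t i.
  by rewrite ffunE enum_valP enum_valK_in cast_ordKV.
exists mm; last by apply: eq_from_tnth => i; rewrite tnth_mktuple mmE.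
rewrite inE -sE; apply/andP; split.
  apply/eqP; rewrite -[RHS]tm big_tuple; apply: eq_bigr => i _; by rewrite mmE.
by apply/forallP => i; apply/implyP => iA; rewrite ffunE (negbTE iA).
Qed.

End Dimension.

(** * Face spaces *)

Section FaceSpaces.
Variables (R : realType) (d : nat).
Implicit Types (S : {set 'I_d.+1}) (e : 'I_d.+1 -> R).

Lemma rS_notin S : (#|S| <= d)%N -> rS S \notin S.
Proof.
move=> cS; rewrite /rS; case: ifP => // /negbFE h; case: pickP => //= S0.
suff : (d.+1 <= #|S|)%N by rewrite ltnNge cS.
rewrite -[X in (X <= _)%N]card_ord; apply/subset_leq_card/fintype.subsetP => i _.
by have := S0 i => /negbFE.
Qed.

Lemma rS_AS S : rS S \notin AS S.
Proof. by rewrite !inE eqxx orbT. Qed.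

Lemma card_AS S : (#|S| <= d)%N -> #|AS S| = (d - #|S|)%N.
Proof.
move=> cS; have := cardsC (S :|: [set rS S]); rewrite -/(AS S) finset.setUC cardsU1.
rewrite rS_notin // card_ord; lia.
Qed.

(* The initial exponents are those of the paper; after [m] steps the exponent is
   back to [e], see [Qstate_weight]. *)
Definition Qstate S e m mm :=
  rodrigues (rS S) (enum (AS S)) mm
    (fun j => e j + (if j \in AS S then mm j else 0)%:R
              + (if j == rS S then m else 0)%:R, 1).

Definition Qpoly S e m mm : mpoly d.+1 R := (Qstate S e m mm).2.

Lemma Qstate_spec S e m mm :
  rodrigues_spec (rS S) (AS S)
    (fun j => e j + (if j \in AS S then mm j else 0)%:R
              + (if j == rS S then m else 0)%:R)
    (mono (enum (AS S)) mm) (Qstate S e m mm).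
Proof. by apply: rodriguesP (rS_AS S) => i; rewrite mem_enum. Qed.

Lemma mdeg_mono_enum (A : {set 'I_d.+1}) mm :
  mdeg (mono (enum A) mm) = (\sum_(i in A) mm i)%N.
Proof. by rewrite mdeg_mono big_enum. Qed.

Lemma Qstate_weight S e m mm : (\sum_(i in AS S) mm i)%N = m ->
  (Qstate S e m mm).1 =1 e.
Proof.
move=> sm j; case: (Qstate_spec S e m mm) => E _ _ _ _; rewrite {}E.
rewrite monoE ?enum_uniq // mem_enum mdeg_mono_enum sm.
by case: (j \in AS S); case: eqP => _; rewrite ?mul0r ?mul1r; ring.
Qed.

Lemma lap_Qpoly S e m mm : (\sum_(i in AS S) mm i)%N = m ->
  lap e (Qpoly S e m mm) = 0.
Proof.
move=> sm; case: (Qstate_spec S e m mm) => _ L _ _ _.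
by rewrite -(lap_eq _ (Qstate_weight e sm)).
Qed.

Lemma Qpoly_homog S e m mm : (\sum_(i in AS S) mm i)%N = m ->
  Qpoly S e m mm \is homog m.
Proof.
by move=> sm; case: (Qstate_spec S e m mm) => _ _ _; rewrite mdeg_mono_enum sm.
Qed.

Lemma Qpoly_face S e m mm j : (#|S| <= d)%N -> j \in S ->
  mderiv j (Qpoly S e m mm) = 0.
Proof.
move=> cS jS; case: (Qstate_spec S e m mm) => _ _ D _ _; apply: D.
  by apply: contraTneq jS => ->; exact: rS_notin.
by rewrite !inE jS.
Qed.

Lemma kill_Qpoly S e m mm : (\sum_(i in AS S) mm i)%N = m -> -1 < e (rS S) ->
  exists2 c : R, c != 0 &
    kill (rS S) (Qpoly S e m mm) = c *: mpolyX R (mono (enum (AS S)) mm).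
Proof.
move=> sm er; case: (Qstate_spec S e m mm) => _ _ _ _ [c c0 K]; exists c => //.
by apply: c0; rewrite Qstate_weight.
Qed.

(** Both folds are followed step by step. After the last step the weight has returned to the
    exponents [e] ([Qstate_weight]), so the prefactor of [Rfun] cancels it and the polynomial
    cofactor remains. *)
Lemma Rfun_Qpoly S e m mm x : (#|S| <= d)%N -> (\sum_(i in AS S) mm i)%N = m ->
  Defs.interior x -> Rfun S e m mm x = ev (phi (Qpoly S e m mm)) x.
Proof.
move=> cS sm ix; rewrite /Rfun; set g := fun y : 'rV[R]_d => _ * _.
pose T := AS S :|: [set rS S].
have rT : rS S \in T by rewrite !inE eqxx orbT.
pose f0 j : R := e j + (if j \in AS S then mm j else 0)%:R
              + (if j == rS S then m else 0)%:R.
have wT f (y : 'rV[R]_d) : weight T f y =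
    (\prod_(i in AS S) xc y i `^ f i) * xc y (rS S) `^ f (rS S).
  by rewrite /weight /T finset.setUC big_setU1 ?rS_AS //= mulrC.
have gE y : g y = weight T f0 y * ev (phi 1) y.
  rewrite phi1 /ev meval1 mulr1 wT /f0 (negbTE (rS_AS S)) eqxx addr0.
  congr (_ * _); apply: eq_bigr => i iA.
  rewrite iA (_ : (i == rS S) = false) ?addr0 //.
  by apply: contraTF iA => /eqP ->; exact: rS_AS.
have H (s : seq 'I_d.+1) y : {subset s <= AS S} -> Defs.interior y ->
    foldr (fun i h => iter (mm i) (Dop S i) h) g s y =
    weight T (rodrigues (rS S) s mm (f0, 1)).1 y *
    ev (phi (rodrigues (rS S) s mm (f0, 1)).2) y.
  elim: s y => [|i s IH] y sA iy /=; first by rewrite gE.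
  have iA : i \in AS S by apply: sA; rewrite mem_head.
  have iT : i \in T by rewrite inE iA.
  have ir : i != rS S by apply: contraTneq iA => ->; exact: rS_AS.
  have {}IH z : Defs.interior z -> foldr (fun i h => iter (mm i) (Dop S i) h) g s z =
      weight T (rodrigues (rS S) s mm (f0, 1)).1 z *
      ev (phi (rodrigues (rS S) s mm (f0, 1)).2) z.
    by move=> iz; apply: IH => // j js; apply: sA; rewrite inE js orbT.
  elim: (mm i) y iy => [|k IHk] y iy /=; first exact: IH.
  move: IHk; set st := iter k (rodrigues_step _ _) _; case: st => f G /= IHk.
  exact: (Dop_weight iT rT ir iy IHk).
rewrite (H _ _ _ ix) => [|j]; last by rewrite mem_enum.
rewrite -/(Qstate S e m mm) -/T -/(Qpoly S e m mm) mulrA.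
suff -> : (\prod_(i in T) xc x i `^ - e i) * weight T (Qstate S e m mm).1 x = 1.
  by rewrite mul1r.
rewrite /weight -big_split big1 //= => j _; rewrite Qstate_weight // -powRD.
  by rewrite addNr powRr0.
by rewrite addNr eqxx /= gt_eqF // ix.
Qed.

Definition multi_index S m (mm : {ffun 'I_d.+1 -> 'I_m.+1}) :=
  ((\sum_(i in AS S) (mm i : nat))%N == m) &&
  [forall i, (i \notin AS S) ==> ((mm i : nat) == 0%N)].

(** The pointwise condition on the interior becomes an identity of polynomials; from here on the
    face spaces are purely algebraic. *)
Lemma HspE S e m p : (#|S| < d)%N -> Hsp S e (Posz m) p <->
  exists c : {ffun 'I_d.+1 -> 'I_m.+1} -> R,
    p = \sum_(mm | multi_index S mm) c mm *: phi (Qpoly S e m (fun i => mm i)).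
Proof.
move=> cS; rewrite /Hsp leqNgt cS /=.
have E (c : {ffun 'I_d.+1 -> 'I_m.+1} -> R) x : Defs.interior x ->
    \sum_(mm | multi_index S mm) c mm * Rfun S e m (fun i => mm i) x =
    ev (\sum_(mm | multi_index S mm) c mm *: phi (Qpoly S e m (fun i => mm i))) x.
  move=> ix; rewrite /ev (raddf_sum (meval _)) /=; apply: eq_bigr => mm.
  move=> /andP[/eqP sm _]; rewrite mevalZ -/(ev _ x) -Rfun_Qpoly // ltnW //.
split=> [[c hc]|[c ->]]; exists c; last by move=> x ix; rewrite -E.
apply/eqP; rewrite -subr_eq0; apply/eqP/ev_interior_inj => x ix.
by rewrite /ev mevalB -!/(ev _ x) hc // -E // subrr.
Qed.

Lemma Hsp_lift S e m p : (#|S| < d)%N -> Hsp S e (Posz m) p ->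
  exists F, [/\ p = phi F, F \is homog m, lap e F = 0
    & forall j, j \in S -> mderiv j F = 0].
Proof.
move=> cS /(HspE _ _ _ cS)[c ->].
exists (\sum_(mm | multi_index S mm) c mm *: Qpoly S e m (fun i => mm i)); split.
- by rewrite phi_sum; apply: eq_bigr => mm _; rewrite phiZ.
- by apply: homog_sum => mm /andP[/eqP sm _]; apply: dhomogZ; apply: Qpoly_homog.
- rewrite lap_sum big1 // => mm /andP[/eqP sm _].
  by rewrite lapZ lap_Qpoly // scaler0.
- move=> j jS; rewrite (raddf_sum (mderiv j)) big1 // => mm _.
  by rewrite /= mderivZ Qpoly_face ?scaler0 // ltnW.
Qed.

Lemma mono_multi_inj S m (mm mm' : {ffun 'I_d.+1 -> 'I_m.+1}) :
  multi_index S mm -> multi_index S mm' ->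
  mono (enum (AS S)) (fun i => mm i) = mono (enum (AS S)) (fun i => mm' i) ->
  mm = mm'.
Proof.
move=> /andP[_ /forallP a0] /andP[_ /forallP b0] E; apply/ffunP => i.
apply: val_inj => /=; have [iA|iA] := boolP (i \in AS S).
  have := congr1 (fun t : multinom _ => t i) E.
  by rewrite !monoE ?enum_uniq // mem_enum iA.
have /implyP/(_ iA)/eqP -> := a0 i; by have /implyP/(_ iA)/eqP -> := b0 i.
Qed.

Lemma Qpoly_free S e m (c : {ffun 'I_d.+1 -> 'I_m.+1} -> R) : -1 < e (rS S) ->
  \sum_(mm | multi_index S mm) c mm *: Qpoly S e m (fun i => mm i) = 0 ->
  forall mm, multi_index S mm -> c mm = 0.
Proof.
move=> er s0 mm0 mm0P.
have := congr1 (mcoeff (mono (enum (AS S)) (fun i => mm0 i)) \o kill (rS S)) s0.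
rewrite /= /kill raddf0 mcoeff0 (raddf_sum (comp_mpoly _)) /= raddf_sum /=.
rewrite (bigD1 mm0) //= big1 ?addr0.
  have /andP[/eqP sm _] := mm0P.
  have [a a0 K] := kill_Qpoly sm er.
  rewrite comp_mpolyZ -/(kill _ _) K !mcoeffZ mcoeffX eqxx mulr1 => /eqP.
  by rewrite mulf_eq0 (negbTE a0) orbF => /eqP.
move=> mm /andP[mmP ne]; have /andP[/eqP sm _] := mmP.
have [a a0 K] := kill_Qpoly sm er.
rewrite comp_mpolyZ -/(kill _ _) K !mcoeffZ mcoeffX (_ : _ == _ = false) ?mulr0 //.
by apply: contraNF ne => /eqP E; apply/eqP; apply: mono_multi_inj E.
Qed.

Lemma Hsp_dim S e m : (#|S| < d)%N -> -1 < e (rS S) ->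
  has_dim (Hsp S e (Posz m)) 'C(m + (d - #|S|) - 1, m).
Proof.
move=> cS er; rewrite -card_AS 1?ltnW // -card_compositions; last first.
  by rewrite card_AS ?subn_gt0 // ltnW.
apply: has_dim_ext (fun p => iff_sym (HspE e m p cS)) _.
apply: (has_dim_span (P := @multi_index S m)) => c s0.
apply: Qpoly_free er _; apply: (@phi_inj _ _ m).
  by apply: homog_sum => mm /andP[/eqP sm _]; apply: dhomogZ; apply: Qpoly_homog.
by rewrite phi_sum -[RHS]s0; apply: eq_bigr => mm _; rewrite phiZ.
Qed.

End FaceSpaces.

(** * Beta and Dirichlet integrals *)

Section BetaIntegral.
Local Open Scope classical_set_scope.
Local Open Scope ring_scope.
Variable R : realType.
Local Notation mu := (@lebesgue_measure R).
Implicit Types (a b s t u v x : R) (f g k : R -> R).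

(** The value is bundled with integrability because the real-valued integral is total, and its
    linearity rests on integrability. *)
Definition has_integral f x :=
  mu.-integrable setT (EFin \o f) /\ \int[mu]_t f t = x.

Lemma has_integralZ c f x : has_integral f x -> has_integral (fun t => c * f t) (c * x).
Proof.
move=> [fi <-]; split; last by rewrite RintegralZl.
by have := integrableZl measurableT c fi.
Qed.

Lemma has_integralD f g x y :
  has_integral f x -> has_integral g y -> has_integral (fun t => f t + g t) (x + y).
Proof.
move=> [fi <-] [gi <-]; split; last by rewrite RintegralD.
by have := integrableD measurableT fi gi.
Qed.

Lemma eq_has_integral f g x : f =1 g -> has_integral f x -> has_integral g x.
Proof. by move=> /funext ->. Qed.

Lemma has_integral0 : has_integral (fun=> 0) 0.
Proof.
split; first exact: integrable0.
by rewrite /Rintegral integral0.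
Qed.

Lemma has_integral_patch A f x : measurable A ->
  mu.-integrable A (EFin \o f) -> \int[mu]_(t in A) f t = x ->
  has_integral (f \_ A) x.
Proof.
move=> mA fi <-; split; last by rewrite [RHS]Rintegral_mkcond.
have := (integrable_mkcond (mu := mu) (EFin \o f) mA).1 fi.
by rewrite restrict_EFin.
Qed.

Lemma has_integral_change f g x y : has_integral g y ->
  (forall t, t != x -> f t = g t) -> has_integral f y.
Proof.
move=> gy fg; have hx : has_integral (cst 0 \_ [set x] : R -> R) 0.
  by apply: has_integral_patch; rewrite ?Rintegral_set1 //; exact: integrable0.
have h1 : has_integral (\1_[set x] : R -> R) 0.
  apply: (@eq_has_integral ((cst 1 : R -> R) \_ [set x])).
    by move=> t; rewrite patchE indicE; case: (_ \in _).
  apply: has_integral_patch; rewrite ?Rintegral_set1 //.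
  apply/integrableP; split; first by apply/measurable_EFinP; exact: measurable_cst.
  under eq_integral do rewrite /= normr1.
  by rewrite integral_cst //= lebesgue_measure_set1 mule0.
have := has_integralD gy (has_integralZ (f x - g x) h1).
rewrite mulr0 addr0; apply: eq_has_integral => t; rewrite indicE.
have [->|tx] := eqVneq t x; first by rewrite mem_set // mulr1 subrKC.
by rewrite memNset ?mulr0 ?addr0 ?fg //= => /eqP; rewrite (negbTE tx).
Qed.

(* The kernel may be singular at both ends of [0, s], so integrals over [0, s] are
   limits of integrals over [s * trim n, s * (1 - trim n)], where FTC applies. *)
Definition trim n : R := n.+3%:R^-1.

(** The offset 3 in [trim] keeps it below 1/2, so that each trimmed segment is nondegenerate. *)
Lemma trim_itv n : 0 < trim n < 2^-1.
Proof. by rewrite invr_gt0 ltr0n /= ltf_pV2 ?posrE ?ltr0n // ltr_nat. Qed.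

Lemma cvg_trim : trim n @[n --> \oo] --> (0 : R).
Proof.
have := @cvg_harmonic R => /(cvg_comp _ _ (cvg_addnr 2)).
rewrite (_ : _ \o _ = trim) //; apply/funext => n.
by rewrite /= /trim addn2.
Qed.

(** Monotone convergence. A point [t] is caught as soon as [s * trim n] is at most its distance
    [min t (s - t)] to the end points. *)
Lemma integral_trim s k : 0 < s -> measurable_fun setT k ->
  (forall t, 0 < t < s -> 0 <= k t) ->
  (\int[mu]_(t in `[(s * trim n)%R, (s * (1 - trim n))%R]) (k t)%:E)%E @[n --> \oo]
  --> (\int[mu]_(t in `]0%R, s[) (k t)%:E)%E.
Proof.
move=> s0 mk k0.
have sub n : `[s * trim n, s * (1 - trim n)] `<=` `]0, s[.
  move=> t /=; rewrite !in_itv /= => /andP[h1 h2]; have /andP[t1 t2] := trim_itv n.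
  apply/andP; split; first by apply: lt_le_trans h1; rewrite mulr_gt0.
  by apply: le_lt_trans h2 _; rewrite gtr_pMr // ltrBlDr ltrDl.
have -> : `]0, s[%classic = \bigcup_n `[s * trim n, s * (1 - trim n)]%classic.
  apply/seteqP; split=> [t /=|t [n _] /sub//].
  rewrite in_itv /= => /andP[t0 ts].
  pose m := Num.min t (s - t).
  have m0 : 0 < m by rewrite lt_min t0 subr_gt0.
  exists (Num.bound (s / m)) => //=; rewrite in_itv /=.
  have h : s * trim (Num.bound (s / m)) <= m.
    rewrite /trim ler_pdivrMr ?ltr0n // mulrC -ler_pdivrMr //.
    apply: (le_trans (ltW (archi_boundP _))); first by rewrite divr_ge0 // ltW.
    by rewrite ler_nat -addn3 leq_addr.
  have mt : m <= t by rewrite ge_min lexx.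
  have ms : m <= s - t by rewrite ge_min lexx orbT.
  by rewrite (le_trans h mt) /= mulrBr mulr1 lerBrDr addrC -lerBrDr (le_trans h).
apply: ge0_nondecreasing_set_cvg_integral.
- move=> n m nm; rewrite subsetEset => t /=; rewrite !in_itv /= => /andP[h1 h2].
  have h : trim m <= trim n by rewrite lef_pV2 ?posrE ?ltr0n // ler_nat.
  rewrite (le_trans _ h1) ?ler_pM2l //= (le_trans h2) // ler_pM2l //.
  by rewrite lerB.
- by move=> i; exact: measurable_itv.
- by move=> i; apply/measurable_EFinP; apply: measurable_funTS.
- move=> i t /sub /=; rewrite in_itv /= => h; rewrite lee_fin; exact: k0.
Qed.

Lemma integral_trim_real s k (I : nat -> R) x : 0 < s -> measurable_fun setT k ->
  (forall t, 0 < t < s -> 0 <= k t) ->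
  (forall n, mu.-integrable `[s * trim n, s * (1 - trim n)] (EFin \o k)) ->
  (forall n, \int[mu]_(t in `[s * trim n, s * (1 - trim n)]) k t = I n) ->
  I n @[n --> \oo] --> x -> has_integral (k \_ `]0, s[) x.
Proof.
move=> s0 mk k0 ik kI Ix.
have E n : (\int[mu]_(t in `[(s * trim n)%R, (s * (1 - trim n))%R]) (k t)%:E)%E = (I n)%:E.
  by rewrite -kI /Rintegral fineK //; apply: integrable_fin_num.
have := integral_trim s0 mk k0; rewrite (funext E) => h.
have kx : (\int[mu]_(t in `]0%R, s[) (k t)%:E)%E = x%:E.
  apply: (cvg_unique _ h); rewrite ?ereal_hausdorff //.
  by apply/fine_cvgP; split; [exact: nearW|exact: Ix].
apply: has_integral_patch => //.
  apply/integrableP; split; first by apply/measurable_EFinP; apply: measurable_funTS.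
  rewrite (_ : (\int[mu]_(t in _) _)%E = x%:E) ?ltry // -kx.
  apply: eq_integral => t; rewrite inE /= in_itv /= => ht.
  by rewrite /= ger0_norm // k0.
by rewrite /Rintegral kx.
Qed.

Lemma FTC_segment f F u v : u < v ->
  (forall t, u <= t <= v -> is_derive t 1 F (f t)) ->
  (forall t, u <= t <= v -> {for t, continuous f}) ->
  mu.-integrable `[u, v] (EFin \o f) /\ \int[mu]_(t in `[u, v]) f t = F v - F u.
Proof.
move=> uv dF cf.
have wf : {within `[u, v], continuous f}.
  apply: continuous_in_subspaceT => t; rewrite inE /= in_itv /=; exact: cf.
have cF t : u <= t <= v -> {for t, continuous F}.
  move=> ht; apply: differentiable_continuous; apply/derivable1_diffP.
  by have [] := dF t ht.
split; first by apply: continuous_compact_integrable => //; exact: segment_compact.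
rewrite /Rintegral (@continuous_FTC2 _ f F) //.
- split.
  + move=> t; rewrite in_itv /= => /andP[/ltW ut /ltW tv].
    by have [] := dF t (introT andP (conj ut tv)).
  + apply: cvg_at_right_filter; apply: cF; by rewrite lexx ltW.
  + apply: cvg_at_left_filter; apply: cF; by rewrite lexx ltW.
- move=> t; rewrite in_itv /= => /andP[/ltW ut /ltW tv]; rewrite derive1E.
  by have [_ ->] := dF t (introT andP (conj ut tv)).
Qed.

Lemma one_powR a : 1 `^ a = 1 :> R.
Proof. by rewrite powR1. Qed.

Definition beta_kernel a b s t := t `^ a * (s - t) `^ b.

Lemma beta_kernel_ge0 a b s t : 0 <= beta_kernel a b s t.
Proof. by rewrite mulr_ge0 // powR_ge0. Qed.

Lemma measurable_beta_kernel a b s : measurable_fun setT (beta_kernel a b s).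
Proof.
apply: measurable_funM; first exact: measurable_powR.
apply: (measurableT_comp (measurable_powR b)).
by apply: measurable_funB => //; exact: measurable_cst.
Qed.

Lemma is_derive_powR_reflect b s t : t < s ->
  is_derive t 1 (fun y => (s - y) `^ b) (- (b * (s - t) `^ (b - 1))).
Proof.
move=> ts; have h0 : 0 < s - t by rewrite subr_gt0.
have := @is_derive1_comp _ (fun y : R => y `^ b) (fun y => s - y) t _ (-1)
  (is_derive1_powR _ h0).
rewrite mulrN1; apply.
by rewrite -[X in is_derive _ _ _ X]add0r; apply: is_deriveD.
Qed.

Lemma is_derive_beta_kernel a b s t : 0 < t < s ->
  is_derive t 1 (beta_kernel a b s)
    (a * beta_kernel (a - 1) b s t - b * beta_kernel a (b - 1) s t).
Proof.
move=> /andP[t0 ts].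
have := is_deriveM (is_derive1_powR a t0) (is_derive_powR_reflect b ts).
move=> h; apply: is_derive_eq; rewrite /beta_kernel.
by rewrite /GRing.scale /=; ring.
Qed.

Lemma continuous_beta_kernel a b s t : 0 < t < s ->
  {for t, continuous (beta_kernel a b s)}.
Proof.
move=> ht; apply: differentiable_continuous; apply/derivable1_diffP.
by have [] := is_derive_beta_kernel a b ht.
Qed.

Lemma trim_segment s n t : 0 < s ->
  s * trim n <= t <= s * (1 - trim n) -> 0 < t < s.
Proof.
move=> s0 /andP[h1 h2]; have /andP[t1 t2] := trim_itv n.
rewrite (lt_le_trans _ h1) ?mulr_gt0 //= (le_lt_trans h2) // gtr_pMr //.
by rewrite ltrBlDr ltrDl.
Qed.

Lemma trim_lt s n : 0 < s -> s * trim n < s * (1 - trim n).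
Proof. by move=> s0; rewrite ltr_pM2l //; have /andP[? ?] := trim_itv n; lra. Qed.

Lemma beta_kernel_segment a b s n : 0 < s ->
  mu.-integrable `[s * trim n, s * (1 - trim n)] (EFin \o beta_kernel a b s).
Proof.
move=> s0; apply: continuous_compact_integrable; first exact: segment_compact.
apply: continuous_in_subspaceT => t; rewrite inE /= in_itv /= => /(trim_segment s0).
exact: continuous_beta_kernel.
Qed.

Definition beta_trim a b n :=
  \int[mu]_(t in `[1 * trim n, 1 * (1 - trim n)]) beta_kernel a b 1 t.

(** On either half of the interval one of the two powers is at most 2, so the kernel is below
    [2 (t^a + (1 - t)^b)]. The constant bounds the increment of the antiderivative of this majorant,
    uniformly in [n]. *)
Lemma beta_trim_le a b n : -1 < a -> -1 < b ->
  beta_trim a b n <= 2 * ((a + 1)^-1 + (b + 1)^-1).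
Proof.
move=> a1 b1; have a0 : 0 < a + 1 by lra.
have b0 : 0 < b + 1 by lra.
pose h t : R := 2 * (t `^ a + (1 - t) `^ b).
pose H t : R := 2 * ((a + 1)^-1 * t `^ (a + 1) - (b + 1)^-1 * (1 - t) `^ (b + 1)).
have lt01 : 0 < 1 :> R by [].
have dH t : 1 * trim n <= t <= 1 * (1 - trim n) -> is_derive t 1 H (h t).
  move=> /(trim_segment lt01) /andP[t0 t1].
  have d1 := is_deriveZ (a + 1)^-1 (is_derive1_powR (a + 1) t0).
  have d2 := is_deriveZ (b + 1)^-1 (is_derive_powR_reflect (b + 1) t1).
  have := is_deriveZ (2 : R) (is_deriveB d1 d2).
  move=> h0; apply: is_derive_eq; rewrite /GRing.scale /= /h !addrK.
  by field; rewrite !gt_eqF.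
have ch t : 1 * trim n <= t <= 1 * (1 - trim n) -> {for t, continuous h}.
  move=> /(trim_segment lt01) /andP[t0 t1].
  apply: differentiable_continuous; apply/derivable1_diffP.
  have d1 := is_derive1_powR a t0; have d2 := is_derive_powR_reflect b t1.
  by have [] := is_deriveZ (2 : R) (is_deriveD d1 d2).
have [ih hE] := FTC_segment (trim_lt n lt01) dH ch.
apply: (@le_trans _ _ (H (1 * (1 - trim n)) - H (1 * trim n))).
  rewrite -hE; apply: le_Rintegral => //; first exact: beta_kernel_segment.
  move=> t /=; rewrite in_itv /= => /(trim_segment lt01) /andP[t0 t1].
  (* For a base at most 1 and an exponent above -1, [y^c <= y^(-1) <= 2]. *)
  have bound (c y : R) : -1 < c -> 2^-1 <= y <= 1 -> y `^ c <= 2.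
    move=> c1 /andP[y1 y2]; have y0 : 0 < y by lra.
    have : y `^ c <= y `^ (-1).
      by apply: ger_powR; [rewrite y0 y2|exact: ltW].
    move/le_trans; apply; rewrite powR_inv1 ?(ltW y0) //.
    by rewrite -[leRHS]invrK lef_pV2 ?posrE ?invr_gt0.
  rewrite /beta_kernel /h mulrDr.
  have [tl|tg] := leP t 2^-1.
    apply: (@le_trans _ _ (2 * t `^ a)); last by rewrite lerDl mulr_ge0 ?powR_ge0.
    rewrite mulrC ler_wpM2r ?powR_ge0 //; apply: bound => //; lra.
  apply: (@le_trans _ _ (2 * (1 - t) `^ b)); last by rewrite lerDr mulr_ge0 ?powR_ge0.
  rewrite ler_wpM2r ?powR_ge0 //; apply: bound => //; lra.
have /andP[t1 t2] := trim_itv n.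
have p1 (c y : R) : 0 < c -> 0 <= y <= 1 -> 0 <= y `^ c <= 1.
  move=> c0 /andP[y0 y1]; rewrite powR_ge0 /= -[leRHS](one_powR c).
  by apply: ge0_ler_powR; rewrite ?nnegrE //; exact: ltW.
rewrite /H !mul1r.
have /andP[A1 A2] := p1 (a + 1) (1 - trim n) a0 (ltac:(lra)).
have /andP[A3 A4] := p1 (a + 1) (trim n) a0 (ltac:(lra)).
have /andP[A5 A6] := p1 (b + 1) (1 - (1 - trim n)) b0 (ltac:(lra)).
have /andP[A7 A8] := p1 (b + 1) (1 - trim n) b0 (ltac:(lra)).
have ai : 0 < (a + 1)^-1 by rewrite invr_gt0.
have bi : 0 < (b + 1)^-1 by rewrite invr_gt0.
move: ((a + 1)^-1) ((b + 1)^-1) ai bi A1 A2 A3 A4 A5 A6 A7 A8 => p q.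
move: (_ `^ (a + 1)) (_ `^ (a + 1)) (_ `^ (b + 1)) (_ `^ (b + 1)) => *; nra.
Qed.

(** Euler's B(a + 1, b + 1): the parameters are shifted by one so as to be the exponents of the
    weight. *)
Definition beta a b := \int[mu]_t (beta_kernel a b 1 \_ `]0, 1[) t.

Lemma beta_trim_cvg a b : -1 < a -> -1 < b ->
  beta_trim a b n @[n --> \oo] --> beta a b.
Proof.
move=> a1 b1; have lt01 : 0 < 1 :> R by [].
have h := integral_trim lt01 (measurable_beta_kernel a b 1)
  (fun t _ => beta_kernel_ge0 a b 1 t).
have E n : (\int[mu]_(t in `[(1 * trim n)%R, (1 * (1 - trim n))%R])
    (beta_kernel a b 1 t)%:E)%E = (beta_trim a b n)%:E.
  rewrite /beta_trim /Rintegral fineK //; apply: integrable_fin_num => //.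
  exact: beta_kernel_segment.
rewrite (funext E) in h.
set L := (\int[mu]_(t in `]0%R, 1%R[) _)%E in h.
have L0 : (0 <= L)%E by apply: integral_ge0 => t _; rewrite lee_fin beta_kernel_ge0.
have LC : (L <= (2 * ((a + 1)^-1 + (b + 1)^-1))%:E)%E.
  rewrite -(cvg_lim _ h) //; apply: lime_le; first by apply/cvg_ex; exists L.
  by apply: nearW => n; rewrite lee_fin; exact: beta_trim_le.
have Lf : L = (fine L)%:E by rewrite fineK // ge0_fin_numE // (le_lt_trans LC) ?ltry.
rewrite Lf in h; have [_ hc] := (fine_cvgP _ _).1 h.
suff -> : beta a b = fine L by [].
have [_ E1] := integral_trim_real lt01 (measurable_beta_kernel a b 1)
  (fun t _ => beta_kernel_ge0 a b 1 t)
  (fun n => beta_kernel_segment a b n lt01) (fun n => erefl) hc.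
exact: E1.
Qed.

(** The substitution [t = s u], made on the trimmed segments; these are proportional to [s] so that
    they correspond to the ones for [s = 1]. *)
Lemma has_integral_beta_kernel a b s : 0 < s -> -1 < a -> -1 < b ->
  has_integral (beta_kernel a b s \_ `]0, s[) (s `^ (a + b + 1) * beta a b).
Proof.
move=> s0 a1 b1; apply: (@integral_trim_real s _
  (fun n => s `^ (a + b + 1) * beta_trim a b n)) => //.
- exact: measurable_beta_kernel.
- by move=> t _; exact: beta_kernel_ge0.
- by move=> n; exact: beta_kernel_segment.
- move=> n; have lt01 : 0 < 1 :> R by [].
  have dF t : is_derive t 1 ( *%R s) s.
    by have := is_deriveZ s (is_derive_id t (1 : R)); rewrite /GRing.scale /= mulr1.
  have FE : derive1 ( *%R s : R -> R) = cst s.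
    by apply/funext => t; rewrite derive1E; have [_ ->] := dF t.
  have uv : trim n <= 1 - trim n by have /andP[? ?] := trim_itv n; lra.
  have cF : continuous ( *%R s : R -> R).
    move=> t; apply: differentiable_continuous; apply/derivable1_diffP.
    by have [] := dF t.
  have := @integration_by_substitution_increasing _ ( *%R s) (beta_kernel a b s) _ _ uv.
  rewrite FE /Rintegral => -> //; first last.
  + apply: continuous_in_subspaceT => t; rewrite inE /= in_itv /= => /(trim_segment s0).
    exact: continuous_beta_kernel.
  + split; first by move=> t _; have [] := dF t.
      by apply: cvg_at_right_filter; exact: cF.
    by apply: cvg_at_left_filter; exact: cF.
  + exact: is_cvg_cst.
  + exact: is_cvg_cst.
  + by move=> t _; exact: cvg_cst.
  + by move=> x y _ _ xy; rewrite ltr_pM2l.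
  rewrite /beta_trim -RintegralZl //; last exact: beta_kernel_segment.
  rewrite /Rintegral !mul1r; congr fine; apply: eq_integral => t.
  rewrite inE /= in_itv /= => ht; have := @trim_segment 1 n t lt01.
  rewrite !mul1r => /(_ ht)/andP[t0 t1].
  congr EFin; transitivity (beta_kernel a b s (s * t) * s) => //.
  rewrite /beta_kernel -{2}[s]mulr1 -mulrBr.
  rewrite !powRM ?ltW ?subr_gt0 // powRD; last by rewrite (gt_eqF s0) implybT.
  rewrite powRD; last by rewrite (gt_eqF s0) implybT.
  by rewrite powRr1 ?ltW //=; ring.
- by apply: cvgMr; exact: beta_trim_cvg.
Qed.

Lemma betaD a b : -1 < a -> -1 < b -> beta (a + 1) b + beta a (b + 1) = beta a b.
Proof.
move=> a1 b1; have lt01 : 0 < 1 :> R by [].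
have a2 : -1 < a + 1 by lra.
have b2 : -1 < b + 1 by lra.
have h := has_integralD (has_integral_beta_kernel lt01 a2 b1)
  (has_integral_beta_kernel lt01 a1 b2).
rewrite !powR1 !mul1r in h; have [_ <-] := h.
congr (Rintegral mu setT _); apply/funext => t; rewrite !patchE.
case: ifPn; last by rewrite addr0.
rewrite inE /= in_itv /= => /andP[t0 t1]; rewrite /beta_kernel.
rewrite (powRD (r := a)); last by rewrite (gt_eqF t0) implybT.
rewrite (powRD (r := b)); last by rewrite subr_eq0 (gt_eqF t1) implybT.
by rewrite !powRr1 ?subr_ge0 ?ltW //; ring.
Qed.

(** Integration by parts: the difference of the two sides is the increment of
    [t^(a+1) (1 - t)^(b+1)], whose limits at 0 and 1 vanish because [a + 1] and [b + 1] are
    positive. With [betaD] this determines both moment ratios. *)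
Lemma beta_swap a b : -1 < a -> -1 < b ->
  (a + 1) * beta a (b + 1) = (b + 1) * beta (a + 1) b.
Proof.
move=> a1 b1; have lt01 : 0 < 1 :> R by [].
have a2 : -1 < a + 1 by lra.
have b2 : -1 < b + 1 by lra.
pose G := beta_kernel (a + 1) (b + 1) 1.
have E n : (a + 1) * beta_trim a (b + 1) n - (b + 1) * beta_trim (a + 1) b n =
    G (1 - trim n) - G (trim n).
  pose g t := (a + 1) * beta_kernel a (b + 1) 1 t - (b + 1) * beta_kernel (a + 1) b 1 t.
  have dG t : 1 * trim n <= t <= 1 * (1 - trim n) -> is_derive t 1 G (g t).
    move=> /(trim_segment lt01) h.
    by have := is_derive_beta_kernel (a + 1) (b + 1) h; rewrite !addrK.
  have cg t : 1 * trim n <= t <= 1 * (1 - trim n) -> {for t, continuous g}.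
    move=> /(trim_segment lt01) h.
    apply: differentiable_continuous; apply/derivable1_diffP.
    have [d1 _] := is_deriveZ (a + 1) (is_derive_beta_kernel a (b + 1) h).
    have [d2 _] := is_deriveZ (b + 1) (is_derive_beta_kernel (a + 1) b h).
    exact: derivableB d1 d2.
  have [_ gE] := FTC_segment (trim_lt n lt01) dG cg.
  transitivity (\int[mu]_(t in `[1 * trim n, 1 * (1 - trim n)]) g t).
    have i1 := beta_kernel_segment a (b + 1) n lt01.
    have i2 := beta_kernel_segment (a + 1) b n lt01.
    rewrite /beta_trim -!RintegralZl // -RintegralB //.
      exact: (integrableZl _ (a + 1) i1).
    exact: (integrableZl _ (b + 1) i2).
  by rewrite gE !mul1r.
have cu (c : R) : 0 < c -> trim n `^ c @[n --> \oo] --> (0 : R).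
  move=> c0; have /cvg_at_rightP := powR_cvg0 c0; apply; split; last exact: cvg_trim.
  by move=> n; have /andP[] := trim_itv n.
have c1 (c : R) : (1 - trim n) `^ c @[n --> \oo] --> (1 : R).
  suff : (1 - trim n) `^ c @[n --> \oo] --> ((1 - 0) `^ c : R).
    by rewrite [X in X `^ c]subr0 one_powR.
  apply: (cvg_comp (fun n => 1 - trim n) (fun y : R => y `^ c)).
    apply: cvgB; [exact: cvg_cst|exact: cvg_trim].
  have h0 : 0 < 1 - 0 :> R by rewrite subr0.
  have [/derivable1_diffP/differentiable_continuous h _] := is_derive1_powR c h0.
  exact: h.
have G0 : G (1 - trim n) - G (trim n) @[n --> \oo] --> (1 * 0 - 0 * 1 : R).
  apply: cvgB; apply: cvgM; rewrite ?subKr.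
  - exact: c1.
  - by under eq_fun do rewrite subKr; apply: cu; lra.
  - by apply: cu; lra.
  - exact: c1.
have L : (a + 1) * beta_trim a (b + 1) n - (b + 1) * beta_trim (a + 1) b n
    @[n --> \oo] --> ((a + 1) * beta a (b + 1) - (b + 1) * beta (a + 1) b : R).
  by apply: cvgB; apply: cvgMr; exact: beta_trim_cvg.
rewrite (funext E) in L.
have h : (a + 1) * beta a (b + 1) - (b + 1) * beta (a + 1) b = 1 * 0 - 0 * 1.
  by apply: (cvg_unique _ L G0); exact: norm_hausdorff.
by apply/eqP; rewrite -subr_eq0 h mulr0 mul0r subrr.
Qed.

Lemma beta_succl a b : -1 < a -> -1 < b ->
  (a + b + 2) * beta (a + 1) b = (a + 1) * beta a b.
Proof.
by move=> a1 b1; have := beta_swap a1 b1; rewrite -(betaD a1 b1) mulrDr => ->; ring.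
Qed.

Lemma beta_succr a b : -1 < a -> -1 < b ->
  (a + b + 2) * beta a (b + 1) = (b + 1) * beta a b.
Proof.
by move=> a1 b1; have := beta_swap a1 b1; rewrite -(betaD a1 b1) mulrDr => <-; ring.
Qed.

(* The values of [f] at the two end points of [0, s] are irrelevant. *)
Lemma has_integral_beta a b c s f : -1 < a -> -1 < b ->
  (forall t, 0 < t < s -> f t = c * beta_kernel a b s t) ->
  (forall t, t < 0 \/ s < t -> f t = 0) ->
  has_integral f (if 0 < s then c * (s `^ (a + b + 1) * beta a b) else 0).
Proof.
move=> a1 b1 f1 f0; pose g t : R := if 0 < t < s then c * beta_kernel a b s t else 0.
have hg : has_integral g (if 0 < s then c * (s `^ (a + b + 1) * beta a b) else 0).
  case: ifPn => s0.
    have := has_integralZ c (has_integral_beta_kernel s0 a1 b1).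
    apply: eq_has_integral => t; rewrite patchE /g; case: ifPn.
      by rewrite inE /= in_itv /= => ->.
    rewrite notin_setE /= in_itv /= => /negP /negbTE ->; by rewrite mulr0.
  apply: eq_has_integral has_integral0 => t; rewrite /g; case: ifPn => // /andP[t0 ts].
  by rewrite (lt_trans t0 ts) in s0.
pose g1 t := if t == s then f s else g t.
have hg1 : has_integral g1 (if 0 < s then c * (s `^ (a + b + 1) * beta a b) else 0).
  by apply: (has_integral_change (x := s) hg) => t ts; rewrite /g1 (negbTE ts).
apply: (has_integral_change (x := 0) hg1) => t t0; rewrite /g1 /g.
case: eqP => [->//|/eqP ts]; case: ifPn => [/f1//|h].
apply: f0; move: h; rewrite negb_and -!leNgt => /orP[h|h]; [left|right].
  by rewrite lt_neqAle t0.
by rewrite lt_neqAle eq_sym ts.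
Qed.

End BetaIntegral.

(** * Iterated integrals and Dirichlet's formula *)

Section IteratedIntegral.
Variable R : realType.
Local Notation mu := (@lebesgue_measure R).
Implicit Types (F G : seq R -> R) (e : nat -> R).

(** Integrability is demanded at each level and for every value of the outer variables: this is what
    makes the iterated integral linear by plain induction. *)
Fixpoint iintegrable n F : Prop :=
  match n with
  | 0 => True
  | n'.+1 => (forall t, iintegrable n' (fun s => F (t :: s))) /\
      mu.-integrable setT (EFin \o (fun t => iint n' (fun s => F (t :: s))))
  end.

Lemma eq_iint n F G : (forall s, size s = n -> F s = G s) -> iint n F = iint n G.
Proof.
elim: n F G => [|n IH] F G FG /=; first exact: FG.
by congr (Rintegral mu setT _); apply/funext => t; apply: IH => s sn; rewrite FG //= sn.
Qed.

Lemma eq_iintegrable n F G : (forall s, size s = n -> F s = G s) ->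
  iintegrable n F -> iintegrable n G.
Proof.
elim: n F G => [//|n IH] F G FG /= [F1 F2]; split=> [t|].
  by apply: IH (F1 t) => s sn; rewrite FG //= sn.
rewrite -(_ : (fun t => iint n (fun s => F (t :: s))) =
  (fun t => iint n (fun s => G (t :: s)))) //.
by apply/funext => t; apply: eq_iint => s sn; rewrite FG //= sn.
Qed.

Lemma iintZ n c F : iintegrable n F ->
  iintegrable n (fun s => c * F s) /\ iint n (fun s => c * F s) = c * iint n F.
Proof.
elim: n F => [//|n IH] F /= [F1 F2].
have E : (fun t => iint n (fun s => c * F (t :: s))) =
    (fun t => c * iint n (fun s => F (t :: s))).
  by apply/funext => t; have [_] := IH _ (F1 t).
have [h1 h2] := has_integralZ c (conj F2 erefl); rewrite E; split=> //.
by split=> // t; have [] := IH _ (F1 t).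
Qed.

Lemma iintD n F G : iintegrable n F -> iintegrable n G ->
  iintegrable n (fun s => F s + G s) /\
  iint n (fun s => F s + G s) = iint n F + iint n G.
Proof.
elim: n F G => [//|n IH] F G /= [F1 F2] [G1 G2].
have E : (fun t => iint n (fun s => F (t :: s) + G (t :: s))) =
    (fun t => iint n (fun s => F (t :: s)) + iint n (fun s => G (t :: s))).
  by apply/funext => t; have [_] := IH _ _ (F1 t) (G1 t).
have [h1 h2] := has_integralD (conj F2 erefl) (conj G2 erefl); rewrite E; split=> //.
by split=> // t; have [] := IH _ _ (F1 t) (G1 t).
Qed.

Lemma iint_ge0 n F : (forall s, size s = n -> 0 <= F s) -> 0 <= iint n F.
Proof.
elim: n F => [|n IH] F F0 /=; first exact: F0.
by apply: Rintegral_ge0 => t _; apply: IH => s sn; apply: F0; rewrite /= sn.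
Qed.

(** The source of strict positivity: a nonnegative function that is at least [c] on a cube of side
    [2 r] has integral at least [c] times the volume. The outer variable is restricted to its
    interval, and the inner integral is bounded by induction. *)
Lemma iint_ge_cube n F (x : nat -> R) r c : 0 < r -> 0 <= c ->
  iintegrable n F -> (forall s, size s = n -> 0 <= F s) ->
  (forall s, size s = n ->
    (forall i, (i < n)%N -> `|nth 0 s i - x i| < r) -> c <= F s) ->
  0 <= iint n F /\ c * (2 * r) ^+ n <= iint n F.
Proof.
move=> r0 c0; elim: n F x => [|n IH] F x.
  by move=> _ F0 Fc; rewrite expr0 mulr1; split; [exact: F0|exact: Fc].
move=> [F1 F2] F0 Fc.
pose A := `](x 0 - r), (x 0 + r)[%classic : set R.
have mA : mu A = (2 * r)%:E.
  rewrite /A lebesgue_measure_itv /= lte_fin ltrD2l gtrN // -EFinB.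
  by congr EFin; ring.
have hA : has_integral ((cst (c * (2 * r) ^+ n) : R -> R) \_ A) (c * (2 * r) ^+ n.+1).
  apply: has_integral_patch; first exact: measurable_itv.
    apply/integrableP; split; first by apply/measurable_EFinP; exact: measurable_cst.
    rewrite (eq_integral (fun=> `|(c * (2 * r) ^+ n)%:E|%E)) // integral_cst //;
      last exact: measurable_itv.
    by rewrite -[X in (_ * X < _)%E]/(mu A) mA -EFinM ltry.
  rewrite Rintegral_cst //; last exact: measurable_itv.
  by rewrite -[X in fine X]/(mu A) mA /= exprSr mulrA.
have inner t : 0 <= iint n (fun s => F (t :: s)).
  by apply: iint_ge0 => s sn; apply: F0; rewrite /= sn.
split; first by apply: Rintegral_ge0 => t _; exact: inner.
have [i1 <-] := hA; apply: le_Rintegral => // t _; rewrite patchE.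
case: ifPn => [|_]; last exact: inner.
rewrite /A inE /= in_itv /= => tA.
have [||_] := IH (fun s => F (t :: s)) (x \o S) (F1 t).
- by move=> s sn; apply: F0; rewrite /= sn.
- move=> s sn sx; apply: Fc => [|[_|i]] /=; first by rewrite sn.
    by rewrite ltr_norml; move: tA => /andP[? ?]; apply/andP; split; lra.
  by rewrite ltnS => /sx.
- by [].
Qed.

(* Truncated at negative [t], so that products of [ppow]s contain the indicator
   function of the simplex. *)
Definition ppow (t a : R) : R := if 0 <= t then t `^ a else 0.

(** Shaped like [iint]: the head of the list is the outermost variable, and [s] is the mass left for
    the remaining coordinates, the last of which is determined by it. *)
Fixpoint dirichlet n e (s : R) (l : seq R) {struct n} : R :=
  match n with
  | 0 => ppow s (e 0%N)
  | n'.+1 => ppow (head 0 l) (e 0%N) * dirichlet n' (e \o S) (s - head 0 l) (behead l)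
  end.

(* Exponent and constant in Dirichlet's integral over the simplex of size [s],
   see [dirichlet_iint]. *)
Fixpoint dir_exp n e : R :=
  if n is n'.+1 then e 0%N + dir_exp n' (e \o S) + 1 else e 0%N.

Fixpoint dir_cst n e : R :=
  if n is n'.+1 then dir_cst n' (e \o S) * beta (e 0%N) (dir_exp n' (e \o S)) else 1.

Lemma eq_dir_exp n e e' : (forall i, (i <= n)%N -> e i = e' i) ->
  dir_exp n e = dir_exp n e'.
Proof.
elim: n e e' => [|n IH] e e' E /=; first exact: E.
by rewrite E // (IH (e \o S) (e' \o S)) // => i hi; exact: (E i.+1).
Qed.

Lemma eq_dir_cst n e e' : (forall i, (i <= n)%N -> e i = e' i) ->
  dir_cst n e = dir_cst n e'.
Proof.
elim: n e e' => [//|n IH] e e' E /=.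
have E' i : (i <= n)%N -> (e \o S) i = (e' \o S) i by move=> hi; exact: (E i.+1).
by rewrite E // (IH _ _ E') (eq_dir_exp E').
Qed.

Lemma dir_exp_gt n e : (forall i, (i <= n)%N -> -1 < e i) -> -1 < dir_exp n e.
Proof.
elim: n e => [|n IH] e he /=; first exact: he.
have h0 := he 0%N isT; have := IH (e \o S) (fun i h => he i.+1 h); lra.
Qed.

(** By induction the inner integral is a constant times a power of [s - t], which leaves a beta
    integral in [t]. The value at [s = 0] is left open, as it affects a single [t] of the next
    integral. *)
Lemma dirichlet_iint n e s : (forall i, (i <= n)%N -> -1 < e i) ->
  iintegrable n (dirichlet n e s) /\
  (s < 0 -> iint n (dirichlet n e s) = 0) /\
  (0 < s -> iint n (dirichlet n e s) = dir_cst n e * s `^ dir_exp n e).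
Proof.
elim: n e s => [|n IH] e s he /=.
  split=> //; split=> [s0|s0]; first by rewrite /ppow leNgt s0.
  by rewrite mul1r /ppow ltW.
have he' i : (i <= n)%N -> -1 < (e \o S) i by move=> h; exact: (he i.+1).
have h0 := he 0%N isT; have hT := dir_exp_gt he'.
have inner t : iintegrable n (fun l => ppow t (e 0%N) * dirichlet n (e \o S) (s - t) l) /\
    iint n (fun l => ppow t (e 0%N) * dirichlet n (e \o S) (s - t) l) =
    ppow t (e 0%N) * iint n (dirichlet n (e \o S) (s - t)).
  by apply: iintZ; have [] := IH (e \o S) (s - t) he'.
have H : has_integral (fun t => iint n
      (fun l => ppow t (e 0%N) * dirichlet n (e \o S) (s - t) l))
    (if 0 < s then dir_cst n (e \o S) *
      (s `^ (e 0%N + dir_exp n (e \o S) + 1) * beta (e 0%N) (dir_exp n (e \o S))) else 0).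
  apply: has_integral_beta => // [t /andP[t0 ts]|t ht]; rewrite (inner t).2.
    have [_ [_ h]] := IH (e \o S) (s - t) he'.
    rewrite h ?subr_gt0 //; by rewrite /ppow (ltW t0) /beta_kernel; ring.
  case: ht => [t0|st]; first by rewrite /ppow leNgt t0 mul0r.
  have [_ [h _]] := IH (e \o S) (s - t) he'.
  by rewrite h ?mulr0 // subr_lt0.
have [H1 H2] := H; split; first by split=> // t; have [] := inner t.
split=> s0; rewrite H2; first by rewrite ltNge ltW.
by rewrite s0; ring.
Qed.

Lemma dir_exp_succ n e i : (i <= n)%N ->
  dir_exp n (fun j => e j + (j == i)%:R) = dir_exp n e + 1.
Proof.
elim: n e i => [|n IH] e [|i] //= hi.
  have -> : ((fun j => e j + (j == 0%N)%:R) \o S) = e \o S.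
    by apply/funext => j /=; rewrite addr0.
  rewrite addrAC; ring.
have -> : ((fun j => e j + (j == i.+1)%:R) \o S) = (fun j => (e \o S) j + (j == i)%:R).
  by apply/funext.
by rewrite IH // addr0; ring.
Qed.

(** The moment ratio [(e_i + 1) / (|e| + n + 1)] of the Dirichlet distribution. For the first
    coordinate it comes from [beta_succl]; for a later one the total exponent of the tail grows by
    one, and [beta_succr] combines with the induction hypothesis. *)
Lemma dir_cst_succ n e i : (i <= n)%N -> (forall j, (j <= n)%N -> -1 < e j) ->
  (dir_exp n e + 1) * dir_cst n (fun j => e j + (j == i)%:R) = (e i + 1) * dir_cst n e.
Proof.
elim: n e i => [|n IH] e [|i] //= hi he.
  have -> : ((fun j => e j + (j == 0%N)%:R) \o S) = e \o S.
    by apply/funext => j /=; rewrite addr0.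
  have hT : -1 < dir_exp n (e \o S) by apply: dir_exp_gt => j hj; exact: (he j.+1).
  have := beta_succl (he 0%N isT) hT.
  set T := dir_exp n _; set b := beta (_ + 1) T => hb.
  transitivity (dir_cst n (e \o S) * ((e 0%N + T + 2) * b)); first by rewrite /b; ring.
  by rewrite hb; ring.
have -> : ((fun j => e j + (j == i.+1)%:R) \o S) = (fun j => (e \o S) j + (j == i)%:R).
  by apply/funext.
have he' j : (j <= n)%N -> -1 < (e \o S) j by move=> hj; exact: (he j.+1).
have hT := dir_exp_gt he'.
have := beta_succr (he 0%N isT) hT; have := IH (e \o S) i hi he'.
rewrite dir_exp_succ // addr0 /=.
set T := dir_exp n _; set b := beta _ (T + 1); set D := dir_cst n _ => h1 h2.
transitivity (D * ((e 0%N + T + 2) * b)); first by ring.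
rewrite h2; transitivity (((T + 1) * D) * beta (e 0%N) T); first by ring.
by rewrite h1; ring.
Qed.

Lemma dirichletE n e s l : size l = n -> dirichlet n e s l =
  (\prod_(j < n) ppow (nth 0 l j) (e j)) * ppow (s - \sum_(j < n) nth 0 l j) (e n).
Proof.
elim: n e s l => [|n IH] e s [|t l] //=; first by rewrite !big_ord0 mul1r subr0.
move=> [sl]; rewrite IH // !big_ord_recl /= -mulrA; congr (_ * (_ * ppow _ _)).
by rewrite opprD addrA.
Qed.

End IteratedIntegral.

(** * Orthogonality on the simplex *)

Section Orthogonality.
Variables (R : realType) (d : nat).
Implicit Types (F G H : mpoly d.+1 R) (p q : mpoly d R) (e : 'I_d.+1 -> R).
Local Notation wid := (widen_ord (leqnSn d)).

Definition wint e p : R := intT (fun x => ev p x * W e x).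

Definition integrand e F (l : seq R) : R :=
  let x : 'rV[R]_d := \row_(j < d) nth 0 l j in
  \1_(@simplex R d) x * (ev (phi F) x * W e x).

Lemma wintE e F : wint e (phi F) = iint d (integrand e F).
Proof. by []. Qed.

Definition nat_exp e (m : multinom d.+1) (k : nat) : R :=
  e (inord k) + (m (inord k))%:R.

Lemma powR_addn (t a : R) k : 0 <= t -> -1 < a -> t `^ (a + k%:R) = t ^+ k * t `^ a.
Proof.
rewrite le_eqVlt => /predU1P[<- a1|t0 a1].
  (* For a positive shift, [a > -1] makes the exponent positive, so that the convention that zero to
     the power zero is 1 does not interfere. *)
  case: k => [|k]; first by rewrite addr0 expr0 mul1r.
  rewrite expr0n mul0r powR0 //; apply: lt0r_neq0.
  by rewrite -natr1; have := ler0n R k; lra.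
rewrite powRD; last by rewrite (gt_eqF t0) implybT.
by rewrite powR_mulrn ?ltW // mulrC.
Qed.

Lemma integrand_monomial e (m : multinom d.+1) l :
  (forall i, -1 < e i) -> size l = d ->
  integrand e (mpolyX R m) l = dirichlet d (nat_exp e m) 1 l.
Proof.
move=> e1 sl; rewrite dirichletE // /integrand; set x := \row_j _.
transitivity (\prod_i ppow (xc x i) (e i + (m i)%:R)); last first.
  rewrite big_ord_recr /=; congr (_ * _); last first.
    rewrite /nat_exp (_ : inord d = ord_max) ?xc_max; last first.
      by apply: val_inj; rewrite /= inordK.
    by congr (ppow (1 - _) _); apply: eq_bigr => j _; rewrite mxE.
  apply: eq_bigr => j _; rewrite xc_widen mxE /nat_exp.
  by rewrite (_ : inord j = wid j) //; apply: val_inj; rewrite /= inordK // ltnS ltnW.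
rewrite indicE; have [xS|xS] := boolP (x \in @simplex R d).
  rewrite mul1r ev_phi mevalX /W -big_split; apply: eq_bigr => i _ /=.
  have xi : 0 <= xc x i by move: xS; rewrite inE => /(_ i).
  by rewrite /ppow xi powR_addn.
have [i xi] : exists i, xc x i < 0.
  apply: contrapT => h; move/negP: xS; apply; rewrite inE => i.
  by rewrite leNgt; apply/negP => xi; apply: h; exists i.
by rewrite mul0r (bigD1 i) //= /ppow leNgt xi mul0r.
Qed.

Lemma integrandD e F G l : integrand e (F + G) l = integrand e F l + integrand e G l.
Proof. by rewrite /integrand /= phiD /ev mevalD; ring. Qed.

Lemma integrandZ e c F l : integrand e (c *: F) l = c * integrand e F l.
Proof. by rewrite /integrand /= phiZ /ev mevalZ; ring. Qed.

Lemma nat_exp_gt e (m : multinom d.+1) : (forall i, -1 < e i) ->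
  forall k, -1 < nat_exp e m k.
Proof.
move=> e1 k; rewrite /nat_exp.
by have := e1 (inord k); have := ler0n R (m (inord k)); lra.
Qed.

Lemma iintegrable_integrand e F : (forall i, -1 < e i) ->
  iintegrable d (integrand e F).
Proof.
move=> e1; have im m : iintegrable d (integrand e (mpolyX R m)).
  apply: (@eq_iintegrable _ _ (dirichlet d (nat_exp e m) 1)).
    by move=> l sl; rewrite integrand_monomial.
  by have [] := @dirichlet_iint _ d (nat_exp e m) 1 (fun i _ => nat_exp_gt m e1 i).
elim/mpolyind: F => [|c m p _ _ IH].
  apply: (@eq_iintegrable _ _ (fun l => 0 * integrand e (mpolyX R mnm0) l)).
    by move=> l _; rewrite -integrandZ scale0r.
  by have [] := iintZ 0 (im mnm0).
have [h _] := iintZ c (im m); have [h2 _] := iintD h IH.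
by apply: eq_iintegrable h2 => l _; rewrite integrandD integrandZ.
Qed.

Lemma wint_phiD e F G : (forall i, -1 < e i) ->
  wint e (phi (F + G)) = wint e (phi F) + wint e (phi G).
Proof.
move=> e1; have [_ <-] := iintD (iintegrable_integrand F e1) (iintegrable_integrand G e1).
by rewrite wintE; apply: eq_iint => l _; rewrite integrandD.
Qed.

Lemma wint_phiZ e c F : (forall i, -1 < e i) ->
  wint e (phi (c *: F)) = c * wint e (phi F).
Proof.
move=> e1; have [_ <-] := iintZ c (iintegrable_integrand F e1).
by rewrite wintE; apply: eq_iint => l _; rewrite integrandZ.
Qed.

Lemma phi_surj p : exists F, phi F = p.
Proof.
have [F _ E] := @phi_lift R d (mmeasure mdeg p) p (leqnSn _); by exists F.
Qed.

Lemma wintD e p q : (forall i, -1 < e i) -> wint e (p + q) = wint e p + wint e q.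
Proof.
move=> e1; have [F <-] := phi_surj p; have [G <-] := phi_surj q.
by rewrite -phiD wint_phiD.
Qed.

Lemma wintZ e c p : (forall i, -1 < e i) -> wint e (c *: p) = c * wint e p.
Proof. by move=> e1; have [F <-] := phi_surj p; rewrite -phiZ wint_phiZ. Qed.

Lemma wint0 e : (forall i, -1 < e i) -> wint e 0 = 0.
Proof. by move=> e1; rewrite -(scale0r 0) wintZ // mul0r. Qed.

Lemma wint_monomial e m : (forall i, -1 < e i) ->
  wint e (phi (mpolyX R m)) = dir_cst d (nat_exp e m).
Proof.
move=> e1; rewrite wintE (@eq_iint _ _ _ (dirichlet d (nat_exp e m) 1)); last first.
  by move=> l sl; rewrite integrand_monomial.
have [_ [_ h]] := @dirichlet_iint _ d (nat_exp e m) 1 (fun i _ => nat_exp_gt m e1 i).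
by rewrite h // one_powR mulr1.
Qed.

Definition bump1 e i : 'I_d.+1 -> R := fun j => e j + (j == i)%:R.

Lemma bump1_gt e i : (forall j, -1 < e j) -> forall j, -1 < bump1 e i j.
Proof. by move=> e1 j; rewrite /bump1; have := e1 j; have := ler0n R (j == i); lra. Qed.

Lemma wint_bump1 e i F : (forall j, -1 < e j) ->
  wint e (phi (XU i * F)) = wint (bump1 e i) (phi F).
Proof.
move=> e1; have e2 := bump1_gt i e1.
elim/mpolyind: F => [|c m p _ _ IH]; first by rewrite mulr0 phi0 !wint0.
rewrite mulrDr !wint_phiD // IH -scalerAr !wint_phiZ //; congr (_ * _ + _).
rewrite -mpolyXD !wint_monomial //; congr dir_cst; apply/funext => k.
by rewrite /nat_exp /bump1 mnmDE mnm1E natrD eq_sym; ring.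
Qed.

Lemma wint_moment e i m : (forall j, -1 < e j) ->
  (dir_exp d (nat_exp e m) + 1) * wint e (phi (XU i * mpolyX R m)) =
  (e i + (m i)%:R + 1) * wint e (phi (mpolyX R m)).
Proof.
move=> e1; rewrite -mpolyXD !wint_monomial //.
rewrite (eq_dir_cst (e' := fun j => nat_exp e m j + (j == i)%:R)); last first.
  move=> k kd; rewrite /nat_exp mnmDE mnm1E natrD.
  have -> : (i == inord k) = (k == i) by rewrite -val_eqE /= inordK // eq_sym.
  by ring.
have id : (i <= d)%N by rewrite -ltnS.
rewrite dir_cst_succ //; last by move=> j _; exact: nat_exp_gt.
by rewrite /nat_exp inord_val.
Qed.

Lemma rhoZ e i r c F : rho e i r (c *: F) = c *: rho e i r F.
Proof.
rewrite /rho !mderivZ -!mul_mpolyC; ring.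
Qed.

Lemma rho_monomial e i r m : i != r -> rho e i r (mpolyX R m) =
  (e i + (m i)%:R + 1) *: (XU r * mpolyX R m)
  - (e r + (m r)%:R + 1) *: (XU i * mpolyX R m) :> mpoly d.+1 R.
Proof.
move=> ir; have xd j : XU j * d_ j (mpolyX R m) = (m j)%:R *: mpolyX R m :> mpoly d.+1 R.
  rewrite mderivX; have [->|mj] := posnP (m j); first by rewrite !scale0r mulr0.
  rewrite -scalerAr -mpolyXD; congr (_ *: mpolyX R _); apply/mnmP => k.
  by rewrite mnmDE mnmBE mnm1E; case: eqP => [<-|_] //=; rewrite ?add0n ?subn0 // subnKC.
have -> : rho e i r (mpolyX R m) = C (e i + 1) * (XU r * mpolyX R m)
    - C (e r + 1) * (XU i * mpolyX R m)
    + (XU r * (XU i * d_ i (mpolyX R m)) - XU i * (XU r * d_ r (mpolyX R m))).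
  by rewrite /rho; ring.
rewrite !xd -!mul_mpolyC !mpolyCD; ring.
Qed.

(** [rho] times the weight is a total derivative. On a monomial it is a combination of two monomials
    ([rho_monomial]), and [wint_moment] gives them opposite contributions, so no boundary term has
    to be estimated. *)
Lemma wint_rho e i r F : (forall j, -1 < e j) -> i != r -> wint e (phi (rho e i r F)) = 0.
Proof.
move=> e1 ir; elim/mpolyind: F => [|c m p _ _ IH].
  by rewrite -(scale0r 0) rhoZ scale0r phi0 wint0.
rewrite rhoD rhoZ wint_phiD // IH addr0 wint_phiZ // rho_monomial //.
rewrite -scaleNr wint_phiD // !wint_phiZ //.
(* The common denominator [|e| + |m| + d + 1] of the two moments; it is positive, so multiplying by
   it loses nothing. *)
set N := dir_exp d (nat_exp e m) + 1.
have N0 : N != 0.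
  rewrite gt_eqF // /N -ltrBlDr sub0r.
  by apply: dir_exp_gt => k _; exact: nat_exp_gt.
apply/eqP; rewrite mulf_eq0; apply/orP; right; rewrite -(mulrI_eq0 _ (mulfI N0)).
rewrite mulrDr mulNr mulrN [N * (_ * wint e (phi (XU r * _)))]mulrCA.
rewrite [N * (_ * wint e (phi (XU i * _)))]mulrCA /N !wint_moment //.
by apply/eqP; ring.
Qed.

Lemma wint_parts e i r G H : (forall j, -1 < e j) -> i != r ->
  wint e (phi (rho e i r G * H)) = - wint (bump2 e i r) (phi (G * (d_ i H - d_ r H))).
Proof.
move=> e1 ir.
have E : rho e i r (G * H) = rho e i r G * H + XU i * (XU r * (G * (d_ i H - d_ r H))).
  by rewrite /rho !mderivM; ring.
have := wint_rho (G * H) e1 ir; rewrite E wint_phiD // !wint_bump1 //; last exact: bump1_gt.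
by move/eqP; rewrite addr_eq0 => /eqP.
Qed.

Lemma continuous_coord (x : 'rV[R]_d) j : {for x, continuous (fun y : 'rV[R]_d => y ord0 j)}.
Proof. exact: coord_continuous. Qed.

Lemma continuous_ev p (x : 'rV[R]_d) : {for x, continuous (ev p)}.
Proof.
elim/mpoly_mulind: p => [c|p q hp hq|j p hp].
- rewrite (_ : ev _ = fun=> c); first exact: cst_continuous.
  by apply/funext => y; rewrite /ev mevalC.
- rewrite (_ : ev _ = (fun y => ev p y + ev q y)); first exact: continuousD.
  by apply/funext => y; rewrite /ev mevalD.
- rewrite (_ : ev _ = (fun y : 'rV[R]_d => y ord0 j * ev p y)).
    by apply: continuousM => //; exact: continuous_coord.
  by apply/funext => y; rewrite /ev mevalM mevalXU.
Qed.

Lemma continuous_xc (x : 'rV[R]_d) i : {for x, continuous (fun y : 'rV[R]_d => xc y i)}.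
Proof.
rewrite (_ : (fun _ => _) = ev (Xp R i)); first exact: continuous_ev.
by apply/funext => y; rewrite ev_Xp.
Qed.

Lemma continuous_W e (x : 'rV[R]_d) : Defs.interior x -> {for x, continuous (W e)}.
Proof.
move=> ix; rewrite /W; elim: (index_enum _) => [|i s IH].
  rewrite (_ : (fun _ => _) = fun=> 1); first exact: cst_continuous.
  by apply/funext => y; rewrite big_nil.
rewrite (_ : (fun _ => _) =
    (fun y : 'rV[R]_d => xc y i `^ e i * \prod_(j <- s) xc y j `^ e j)); last first.
  by apply/funext => y; rewrite big_cons.
apply: continuousM => //.
apply: (continuous_comp (g := fun t : R => t `^ e i)); first exact: continuous_xc.
apply: differentiable_continuous; apply/derivable1_diffP.
by have [] := is_derive1_powR (e i) (ix i).
Qed.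

Lemma wint_sqr_gt0 e q : (forall j, -1 < e j) -> q != 0 -> 0 < wint e (q * q).
Proof.
move=> e1 q0.
have [x ix qx] : exists2 x, Defs.interior x & ev q x != 0.
  apply: contrapT => h; move/eqP: q0; apply; apply: ev_interior_inj => x ix.
  by apply/eqP/negPn/negP => qx; apply: h; exists x.
pose g (y : 'rV[R]_d) := ev q y * ev q y * W e y.
have Wx : 0 < W e x by apply: prodr_gt0 => i _; rewrite powR_gt0 // ix.
have gx : 0 < g x.
  by rewrite mulr_gt0 // lt_neqAle eq_sym mulf_neq0 //= -expr2 sqr_ge0.
have cg : {for x, continuous g}.
  apply: continuousM; last exact: continuous_W.
  by apply: continuousM; exact: continuous_ev.
have near1 : \forall y \near x, g x / 2 < g y.
  by apply: (cvgr_gt _ cg); rewrite ltr_pdivrMr // ltr_pMr // ltr1n.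
have near2 : \forall y \near x, forall i, 0 < xc y i.
  have near_s (s : seq 'I_d.+1) : \forall y \near x, {in s, forall i, 0 < xc y i}.
    elim: s => [|i s IH]; first by apply: filterS near1 => y _ j.
    have hi : \forall y \near x, 0 < xc y i.
      by apply: (cvgr_gt _ (continuous_xc (i := i))); exact: ix.
    apply: filterS2 hi IH => y h1 h2 j; rewrite inE => /predU1P[->//|/h2//].
  by apply: filterS (near_s (enum 'I_d.+1)) => y h i; apply: h; rewrite mem_enum.
(* Balls of row vectors are cubes, which is the shape required by [iint_ge_cube]. *)
have /nbhs_ballP[r /= r0 hr] : \forall y \near x, simplex y /\ g x / 2 <= g y.
  by apply: filterS2 near1 near2 => y h1 h2; split; [move=> i; exact: ltW|exact: ltW].
have [F Fq] := phi_surj (q * q).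
have [_ h] : 0 <= iint d (integrand e F) /\
    g x / 2 * (2 * r) ^+ d <= iint d (integrand e F).
  apply: (@iint_ge_cube R d _ (fun k => if insub k is Some j then x ord0 j else 0)) => //.
  - by rewrite divr_ge0 // ltW.
  - exact: iintegrable_integrand.
  - move=> l _; rewrite /integrand /= Fq mulr_ge0 // ?indicE ?ler0n //.
    rewrite /ev mevalM -expr2 mulr_ge0 ?sqr_ge0 //.
    by apply: prodr_ge0 => i _; exact: powR_ge0.
  move=> l sl hl; rewrite /integrand /= Fq; set y := \row_j _.
  have [ys gy] : simplex y /\ g x / 2 <= g y.
    apply: hr; split=> // i j; rewrite (ord1 i) /ball /= mxE.
    by have := hl j (ltn_ord j); rewrite (valK j) distrC.
  by rewrite indicE mem_set // mul1r /ev mevalM.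
rewrite -Fq wintE; apply: lt_le_trans h.
by rewrite mulr_gt0 ?divr_gt0 // exprn_gt0 // mulr_gt0.
Qed.

End Orthogonality.

(** * Orthogonal polynomials as the space of the empty face *)

Section JacobiSpaces.
Variables (R : realType) (d : nat).
Implicit Types (F G H : mpoly d.+1 R) (p q : mpoly d R) (e : 'I_d.+1 -> R).
Local Notation wid := (widen_ord (leqnSn d)).
Local Notation set0 := (finset.set0 : {set 'I_d.+1}).

Lemma rS_set0 : rS set0 = ord_max.
Proof. by rewrite /rS finset.in_set0. Qed.

Lemma wint_Qpoly e m (mm : 'I_d.+1 -> nat) q : (forall j, -1 < e j) ->
  (\sum_(i in AS set0) mm i)%N = m -> (mmeasure mdeg q <= m)%N ->
  wint e (phi (Qpoly set0 e m mm) * q) = 0.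
Proof.
move=> e1 sm hq.
(* The claim for partial formulas: after the steps [a], orthogonality to degrees below [mdeg a] in
   the weight of the current state. Exponents only decrease along the steps, so the bound -1 at the
   end gives it at all earlier states. *)
pose P (a : multinom d.+1) (st : ('I_d.+1 -> R) * mpoly d.+1 R) :=
  (forall j, -1 < st.1 j) ->
  forall q, (mmeasure mdeg q <= mdeg a)%N -> wint st.1 (phi st.2 * q) = 0.
suff : P (mono (enum (AS set0)) mm) (Qstate set0 e m mm).
  have E : (Qstate set0 e m mm).1 = e by apply/funext; exact: Qstate_weight.
  by rewrite /P E mdeg_mono_enum sm => /(_ e1 q hq).
rewrite /Qstate rS_set0; apply: rodrigues_ind => [h q'|a st i].
  rewrite mdeg0 leqn0 msize_poly_eq0 => /eqP ->; by rewrite mulr0 wint0.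
rewrite mem_enum !inE rS_set0 /= => im IH h q' hq'.
set f' := (rodrigues_step ord_max i st).1 in h *.
have [|[j ij]] := ord_max_or_widen i; first by move=> E; rewrite E eqxx in im.
have [G Gq] := phi_surj q'.
have E : bump2 f' i ord_max = st.1.
  by apply/funext => l; rewrite /bump2 /f' /rodrigues_step /=; ring.
(* For the empty face [r] is the last index, so [d_i - d_r] dehomogenizes to a partial derivative
   and lowers the degree of [q'] by one. *)
rewrite -Gq -phiM wint_parts // phiM {2}ij -pd_phi Gq E IH ?oppr0 //.
  move=> l; rewrite -E /bump2; have := h l.
  have := ler0n R (l == i); have := ler0n R (l == ord_max); lra.
by apply: msize_mderiv; move: hq'; rewrite mdegD mdeg1 addn1.
Qed.

Lemma mcoeff_kill r F mu :
  mcoeff mu (kill r F) = if mu r == 0%N then mcoeff mu F else 0.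
Proof.
elim/mpolyind: F => [|c m p _ _ IH].
  by rewrite /kill raddf0 mcoeff0 if_same.
have -> : kill r (c *: mpolyX R m + p) = c *: kill r (mpolyX R m) + kill r p.
  by rewrite /kill raddfD /= comp_mpolyZ.
rewrite !mcoeffD !mcoeffZ IH; have -> : kill r (mpolyX R m) =
    if m r == 0%N then mpolyX R m else 0.
  rewrite /kill comp_mpolyX (bigD1 r) //= tnth_mktuple eqxx.
  have [mr|mr] := eqVneq (m r) 0%N; last by rewrite expr0n (negbTE mr) mul0r.
  rewrite mr expr0 mul1r [RHS]mpolyXE_id [RHS](bigD1 r) //= mr expr0 mul1r.
  by apply: eq_bigr => i ir; rewrite tnth_mktuple (negbTE ir).
have [mr|mr] := eqVneq (m r) 0%N; rewrite ?mcoeffX ?mcoeff0.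
  have [//|mur] := eqVneq (mu r) 0%N; rewrite (_ : (m == mu) = false) ?mulr0 ?addr0 //.
  by apply/eqP => E; rewrite -E mr in mur.
rewrite mulr0 add0r; have [mur|//] := eqVneq (mu r) 0%N.
rewrite (_ : (m == mu) = false) ?mulr0 ?add0r //.
by apply/eqP => E; rewrite E mur in mr.
Qed.

Lemma multi_of_mnm m (mu : multinom d.+1) : mdeg mu = m -> mu ord_max = 0%N ->
  exists2 mm : {ffun 'I_d.+1 -> 'I_m.+1}, multi_index set0 mm &
    mono (enum (AS set0)) (fun i => mm i) = mu.
Proof.
move=> dm mr; pose mm : {ffun 'I_d.+1 -> 'I_m.+1} := [ffun i => inord (mu i)].
have mmE i : mm i = mu i :> nat.
  by rewrite ffunE inordK // ltnS -dm mdegE (bigD1 i) //= leq_addr.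
have AE i : (i \in AS set0) = (i != ord_max).
  by rewrite !inE rS_set0.
exists mm; last first.
  apply/mnmP => i; rewrite monoE ?enum_uniq // mem_enum AE mmE.
  by case: eqP => [->|].
apply/andP; split.
  apply/eqP; rewrite -[RHS]dm mdegE [RHS](bigD1 ord_max) //= mr add0n.
  by apply: eq_big => [i|i _]; [rewrite AE|rewrite mmE].
by apply/forallP => i; apply/implyP; rewrite AE negbK mmE => /eqP ->; rewrite mr.
Qed.

Lemma msize_phi_divX F G r N : F = XU r * G -> F \is homog N ->
  (mmeasure mdeg (phi G) <= N)%N.
Proof.
case: N => [|N] E hF; first by rewrite (homog_divX0 E hF) phi0 mmeasure0.
exact: msize_phi (homog_divX E hF).
Qed.

Lemma Vsp_Hsp e m p : (0 < d)%N -> (forall j, -1 < e j) ->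
  Vsp e (Posz m) p <-> Hsp set0 e (Posz m) p.
Proof.
move=> d0 e1; have c0 : (#|set0| < d)%N by rewrite cards0.
have intE p1 p2 : intT (fun x => ev p1 x * ev p2 x * W e x) = wint e (p1 * p2).
  congr intT; apply/funext => x; by rewrite /ev mevalM.
have Horth p1 q : Hsp set0 e (Posz m) p1 -> (mmeasure mdeg q <= m)%N ->
    wint e (p1 * q) = 0.
  move=> /(HspE _ _ _ c0)[c ->] hq; rewrite mulr_suml.
  elim/big_ind: _ => [|x y hx hy|mm /andP[/eqP sm _]]; first exact: wint0.
    by rewrite wintD // hx hy addr0.
  by rewrite -scalerAl wintZ // wint_Qpoly // mulr0.
split=> [[hp orth]|hp]; last first.
  split=> [|q hq]; last by rewrite intE Horth.
  have [F [-> hF _ _]] := Hsp_lift c0 hp; exact: msize_phi.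
have [F hF Fp] := phi_lift hp.
pose Q (mm : {ffun 'I_d.+1 -> 'I_m.+1}) := Qpoly set0 e m (fun i => mm i).
pose mon (mm : {ffun 'I_d.+1 -> 'I_m.+1}) := mono (enum (AS set0)) (fun i => mm i).
pose a mm := mcoeff (mon mm) (kill ord_max (Q mm)).
have aE mm : multi_index set0 mm -> a mm != 0 /\
    kill ord_max (Q mm) = a mm *: mpolyX R (mon mm).
  move=> /andP[/eqP sm _]; have [x x0 K] := kill_Qpoly sm (e1 _).
  rewrite rS_set0 in K.
  have ax : a mm = x by rewrite /a K mcoeffZ mcoeffX eqxx mulr1.
  by rewrite ax.
(* Modulo [X_r] each [Q mm] is [a mm] times its own monomial; with these coefficients the difference
   [F1] has no monomial free of [X_r]. *)
pose c mm := mcoeff (mon mm) F / a mm.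
pose F1 := F - \sum_(mm | multi_index set0 mm) c mm *: Q mm.
have hQ : \sum_(mm | multi_index set0 mm) c mm *: Q mm \is homog m.
  by apply: homog_sum => mm /andP[/eqP sm _]; apply: dhomogZ; apply: Qpoly_homog.
have hF1 : F1 \is homog m by rewrite dhomogD // dhomogN.
have K1 : kill ord_max F1 = 0.
  apply/mpolyP => mu; rewrite mcoeff0 mcoeff_kill; case: eqP => [mur|//].
  have [dm|dm] := eqVneq (mdeg mu) m; last by rewrite (dhomog_nemf_coeff hF1).
  have [mm mmP mmE] := multi_of_mnm dm mur.
  have [am Km] := aE mm mmP.
  rewrite mcoeffB raddf_sum /= (bigD1 mm) //= big1 ?addr0 => [|mm' /andP[mP ne]].
    rewrite mcoeffZ /c -/(mon mm) in mmE *.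
    have -> : mcoeff mu (Q mm) = a mm by rewrite /a mcoeff_kill mmE mur eqxx.
    by rewrite divfK // -/(mon mm) mmE subrr.
  have [_ K'] := aE mm' mP; rewrite mcoeffZ.
  have := mcoeff_kill ord_max (Q mm') mu; rewrite mur eqxx => <-.
  rewrite K' mcoeffZ mcoeffX (_ : _ == _ = false) ?mulr0 //.
  apply: contraNF ne => /eqP E; apply/eqP; apply: (mono_multi_inj mP mmP).
  by rewrite -/(mon mm') E mmE.
(* [F1 = X_r G] is orthogonal to [G], so [G] has norm 0 for the weight [x_r W_e]. *)
have [G F1E] := kill_decomp ord_max F1; rewrite K1 add0r in F1E.
have sE : phi (\sum_(mm | multi_index set0 mm) c mm *: Q mm) =
    \sum_(mm | multi_index set0 mm) c mm *: phi (Q mm).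
  by rewrite phi_sum; apply: eq_bigr => mm _; rewrite phiZ.
have Hs : Hsp set0 e (Posz m) (\sum_(mm | multi_index set0 mm) c mm *: phi (Q mm)).
  by apply/HspE => //; exists c.
suff F10 : phi F1 = 0.
  by move: F10; rewrite /F1 phiB Fp sE => /eqP; rewrite subr_eq0 => /eqP ->.
have hG := msize_phi_divX F1E hF1.
have w0 : wint e (phi F1 * phi G) = 0.
  rewrite /F1 phiB sE Fp mulrBl -scaleN1r -[X in X + _]addr0 wintD // wintZ //.
  by rewrite Horth // addr0 -intE orth // mulr0 addr0.
rewrite F1E phiM -mulrA -!phiM wint_bump1 // phiM in w0.
have G0 : phi G = 0.
  apply/eqP/negPn/negP => G0.
  by have := wint_sqr_gt0 (bump1_gt ord_max e1) G0; rewrite w0 ltxx.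
by rewrite F1E phiM G0 mulr0.
Qed.

End JacobiSpaces.

(** * Direct sums of spaces of polynomials *)

Lemma dep_choice (I : Type) (T : I -> Type) (P : forall i, T i -> Prop) :
  (forall i, exists x, P i x) -> exists f : forall i, T i, forall i, P i (f i).
Proof. by move=> h; exists (fun i => sval (cid (h i))) => i; exact: svalP. Qed.

Section SpacesOfPolynomials.
Variables (R : realType) (d : nat).
Implicit Types (U V : Defs.space R d) (L : seq (Defs.space R d)) (p q : mpoly d R).

Definition subspace U := U 0 /\ forall c p q, U p -> U q -> U (c *: p + q).

Lemma subspace_sum U (I : finType) (c : I -> R) (v : I -> mpoly d R) :
  subspace U -> (forall i, U (v i)) -> U (\sum_i c i *: v i).
Proof.
move=> [U0 UZ] Uv; elim/big_rec: _ => // i p _ Up; exact: UZ.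
Qed.

Lemma has_dim_mulsp q U N : q != 0 -> has_dim U N -> has_dim (mulsp q U) N.
Proof.
move=> q0 [b [bU bf bs]]; exists (fun i => q * b i); split.
- by move=> i; exists (b i).
- move=> c h; apply: bf; apply: (mulfI q0); rewrite mulr0 -[RHS]h mulr_sumr.
  by apply: eq_bigr => i _; rewrite scalerAr.
- move=> _ [u [/bs[c ->] ->]]; exists c; rewrite mulr_sumr.
  by apply: eq_bigr => i _; rewrite scalerAr.
Qed.

Lemma subspace_mulsp q U : subspace U -> subspace (mulsp q U).
Proof.
move=> [U0 UZ]; split; first by exists 0; rewrite mulr0.
move=> c _ _ [u [Uu ->]] [v [Uv ->]]; exists (c *: u + v); split; first exact: UZ.
by rewrite mulrDr scalerAr.
Qed.

Lemma has_dim_zero U : (forall p, U p <-> p = 0) -> has_dim U 0.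
Proof.
move=> U0; exists (fun=> 0); split => [[]//|c _ []//|p /U0 ->].
by exists (fun=> 0); rewrite big_ord0.
Qed.

Lemma has_dim_spanL (s : seq (mpoly d R)) :
  (forall c : 'I_(size s) -> R, \sum_i c i *: s`_i = 0 -> forall i, c i = 0) ->
  has_dim (spanL s) (size s).
Proof.
move=> sf; have := @has_dim_span R d 'I_(size s) predT (fun i => s`_i).
by rewrite card_ord; apply=> c h i _; exact: sf.
Qed.

Lemma has_dim_sumsp L (N : 'I_(size L) -> nat) : direct L ->
  (forall i : 'I_(size L), subspace (nth (@zsp R d) L i)) ->
  (forall i : 'I_(size L), has_dim (nth (@zsp R d) L i) (N i)) ->
  has_dim (sumsp L) (\sum_i N i).
Proof.
move=> dL sL hL.
have [b hb] := dep_choice hL.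
pose I := {i : 'I_(size L) & 'I_(N i)}.
pose v (x : I) := b (tag x) (tagged x).
have sE (c : I -> R) : \sum_(x : I) c x *: v x =
    \sum_i \sum_(j < N i) c (Tagged (fun i => 'I_(N i)) j) *: b i j.
  rewrite (@sig_big_dep _ _ _ _ (fun i => 'I_(N i)) xpredT (fun i => xpredT)
    (fun i j => c (Tagged (fun i => 'I_(N i)) j) *: b i j)) /=.
  by apply: eq_bigr => -[].
have -> : (\sum_i N i)%N = #|xpredT : pred I|.
  rewrite card_tagged sumnE big_map big_enum /=; apply: eq_bigr => i _.
  by rewrite card_ord.
apply: has_dim_ext (has_dim_span _) => [p|c].
  split=> [[c ->]|[u [uL ->]]].
    exists (fun i => \sum_(j < N i) c (Tagged (fun i => 'I_(N i)) j) *: b i j).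
    split=> //; move=> i; apply: subspace_sum => // j; by have [h _ _] := hb i.
  have hu i : exists c : 'I_(N i) -> R, u i = \sum_j c j *: b i j.
    by have [_ _ h] := hb i; exact: h.
  have [c hc] := dep_choice hu.
  exists (fun x => c (tag x) (tagged x)); rewrite sE.
  by apply: eq_bigr => i _; rewrite hc.
move=> c0 [i j] _.
have ui : forall i : 'I_(size L), nth (@zsp R d) L i
    (\sum_(j < N i) c (Tagged (fun i => 'I_(N i)) j) *: b i j).
  by move=> l; apply: subspace_sum => // m; have [h _ _] := hb l.
have := dL _ ui; rewrite -sE => /(_ c0 i) hi.
by have [_ h _] := hb i; exact: (h (fun j => c (Tagged _ j)) hi j).
Qed.

End SpacesOfPolynomials.

(** * The face decomposition *)

Section FaceDecomposition.
Variables (R : realType) (d k : nat) (gam : 'I_d.+1 -> R) (n : nat).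
Hypothesis d2 : (2 <= d)%N.
Hypothesis kd : (1 <= k <= d.+1)%N.
Hypothesis gam1 : forall i : 'I_d.+1, (i < d.+1 - k)%N -> -1 < gam i.
Implicit Types (J : {set 'I_d.+1}) (F G : mpoly d.+1 R).
Local Notation wid := (widen_ord (leqnSn d)).
Local Notation B := (Bset d k).
Local Notation e1 := (gvec gam k (-1)).

Lemma gvec_sum : \sum_i e1 i = abs_gam gam k - k%:R.
Proof.
have k1 : (k <= d.+1)%N by have /andP[] := kd.
rewrite (bigID (fun i : 'I_d.+1 => (i < d.+1 - k)%N)) /=; congr (_ + _).
  by apply: eq_bigr => i hi; rewrite /gvec hi.
rewrite (eq_bigr (fun=> -1)) => [|i /negbTE hi]; last by rewrite /gvec hi.
rewrite sumrN sumr_const; congr (- (_ *+ _)).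
rewrite -sum1_card; transitivity (\sum_(0 <= i < d.+1 | ~~ (i < d.+1 - k)%N) 1)%N.
  by rewrite big_mkord.
rewrite (big_cat_nat _ (n := (d.+1 - k)%N)) //= ?leq_subr //.
rewrite big_nat_cond big1 ?add0n => [|i /andP[/andP[_ ->]]] //.
rewrite big_nat_cond (eq_bigl (fun i => (d.+1 - k <= i < d.+1)%N)).
  by rewrite -big_nat sum_nat_const_nat muln1 subKn.
by move=> i; rewrite -leqNgt; case: (d.+1 - k <= i)%N; rewrite ?andbT ?andbF.
Qed.

Lemma card_B : #|B| = k.
Proof.
have k1 : (k <= d.+1)%N by have /andP[] := kd.
rewrite cardsE -sum1_card; transitivity (\sum_(0 <= i < d.+1 | (d.+1 - k <= i)%N) 1)%N.
  by rewrite big_mkord.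
rewrite (big_cat_nat _ (n := (d.+1 - k)%N)) //= ?leq_subr //.
rewrite big_nat_cond big1 ?add0n => [|i /andP[/andP[_ h]]]; last by rewrite leqNgt h.
rewrite big_nat_cond (eq_bigl (fun i => (d.+1 - k <= i < d.+1)%N)).
  by rewrite -big_nat sum_nat_const_nat muln1 subKn.
by move=> i; case: (d.+1 - k <= i)%N; rewrite ?andbT ?andbF.
Qed.

Lemma epsJ_gt J i : -1 < epsJ gam k J i.
Proof.
rewrite /epsJ; case: ifP => [/gam1//|_]; case: ifP => _; lra.
Qed.

Definition XJ J : mpoly d.+1 R := \prod_(i in J) XU i.

Lemma phi_XJ J : phi (XJ J) = xJ R J.
Proof.
rewrite /phi /XJ rmorph_prod; apply: eq_bigr => i _; exact: phiXU.
Qed.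

Definition mnmJ J : multinom d.+1 := Multinom [tuple (i \in J : nat) | i < d.+1].

Lemma XJE J : XJ J = mpolyX R (mnmJ J).
Proof.
rewrite mpolyXE_id /XJ [LHS]big_mkcond; apply: eq_bigr => i _.
by rewrite mnmE; case: (i \in J); rewrite ?expr1 ?expr0.
Qed.

Lemma XJ_homog J : XJ J \is homog #|J|.
Proof.
rewrite XJE dhomogX /= mdegE -sum1_card [X in _ == X]big_mkcond; apply/eqP.
by apply: eq_bigr => i _; rewrite mnmE; case: (i \in J).
Qed.

Lemma xJ_neq0 J : xJ R J != 0.
Proof.
rewrite -phi_XJ; apply/eqP => /(phi_inj (XJ_homog J)) h.
have := congr1 (mcoeff (mnmJ J)) h; rewrite XJE mcoeffX eqxx mcoeff0 => /eqP.
by rewrite oner_eq0.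
Qed.

(** For [i] in [J] the exponent -1 leaves no first-order term on the left, and [X_i d_i^2 (X_i G) =
    X_i (X_i d_i^2 + 2 d_i) G] is the summand for exponent 1. For [i] in [B :\: J] both summands
    vanish since [G] does not contain [X_i]; outside [B] the exponents agree and [XJ J] is a
    constant for [d_i]. *)
Lemma lap_XJ J G : J \subset B -> (forall j, j \in B :\: J -> mderiv j G = 0) ->
  lap e1 (XJ J * G) = XJ J * lap (epsJ gam k J) G.
Proof.
move=> JB hG; rewrite /lap mulr_sumr; apply: eq_bigr => i _.
have dXJ l (A : {set 'I_d.+1}) : l \notin A -> d_ l (XJ A) = 0.
  move=> lA; rewrite XJE mderivX mnmE (negbTE lA) scale0r //.
have BE : (i \in B) = ~~ (i < d.+1 - k)%N by rewrite inE leqNgt.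
have [iJ|iJ] := boolP (i \in J).
  have iB : i \in B by exact: (fintype.subsetP JB).
  have E : XJ J = XU i * XJ (J :\ i).
    by rewrite /XJ (big_setD1 i).
  rewrite /gvec /epsJ; move: (iB); rewrite BE => /negbTE ->; rewrite iJ E.
  have dA := dXJ i (J :\ i) (negbT (setD11 i J)).
  rewrite !(mderivM, mderivD, mderivXU) eqxx dA !mderiv_nat addNr mpolyC0 mderiv0.
  rewrite mpolyCD mpolyC1 (_ : true%:R = 1 :> mpoly d.+1 R) //; ring.
rewrite !mderivM (dXJ i J iJ) mul0r add0r mderivM (dXJ i J iJ) mul0r add0r.
have [iB|iB] := boolP (i \in B).
  by rewrite hG ?mderiv0 ?mulr0 ?addr0 ?mulr0 // inE iJ.
rewrite /gvec /epsJ; move: (iB); rewrite BE negbK => ->; ring.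
Qed.

Definition face J : Defs.space R d :=
  mulsp (xJ R J) (Hsp (B :\: J) (epsJ gam k J) (n%:Z - #|J|%:Z)).

(* When [#|B :\: J| >= d] the space [Hsp] is 0 by convention; this agrees with the
   dimension formula only in positive degree. *)
Definition admissible J := (J \subset B) && ((#|B :\: J| < d)%N || (0 < n - #|J|)%N).

Lemma subz_Posz a b : (b <= a)%N -> a%:Z - b%:Z = Posz (a - b).
Proof. by move=> h; rewrite subzn. Qed.

Lemma subz_Negz a b : (a < b)%N -> a%:Z - b%:Z = Negz (b - a).-1.
Proof. by move=> h; rewrite NegzE prednK ?subn_gt0 //; lia. Qed.

Lemma subspace_Hsp S (e : 'I_d.+1 -> R) m : subspace (Hsp S e m).
Proof.
case: m => m; last by split=> // c p q -> ->; rewrite scaler0 addr0.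
have [cS|cS] := ltnP #|S| d; last first.
  by rewrite /Hsp cS; split=> // c p q -> ->; rewrite scaler0 addr0.
split; first by apply/HspE => //; exists (fun=> 0); rewrite big1 // => mm _; rewrite scale0r.
move=> c p q /(HspE _ _ _ cS)[a ->] /(HspE _ _ _ cS)[b ->]; apply/HspE => //.
exists (fun mm => c * a mm + b mm); rewrite scaler_sumr -big_split.
by apply: eq_bigr => mm _ /=; rewrite scalerDl scalerA.
Qed.

Lemma face_lift J p : J \subset B -> face J p -> exists F,
  [/\ p = phi F, F \is homog n, lap e1 F = 0
    & forall mu, mcoeff mu F != 0 -> forall i, i \in B -> (0 < mu i)%N = (i \in J)].
Proof.
move=> JB [u [Hu ->]].
(* Covers the two conventions under which the space is zero: negative degree, and a face set with at
   least [d] elements. *)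
have zero : u = 0 -> exists F, [/\ xJ R J * u = phi F, F \is homog n, lap e1 F = 0
    & forall mu, mcoeff mu F != 0 -> forall i, i \in B -> (0 < mu i)%N = (i \in J)].
  move=> ->; exists 0; split; rewrite ?mulr0 ?phi0 ?dhomog0 //.
    by rewrite /lap big1 // => i _; rewrite !mderiv0 !mulr0 addr0.
  by move=> mu; rewrite mcoeff0 eqxx.
have [Jn|Jn] := leqP #|J| n; last first.
  by apply: zero; move: Hu; rewrite subz_Negz.
have [cS|cS] := ltnP #|B :\: J| d; last first.
  by apply: zero; move: Hu; rewrite subz_Posz // /Hsp cS.
rewrite subz_Posz // in Hu; have [G [-> hG lG dG]] := Hsp_lift cS Hu.
exists (XJ J * G); split.
- by rewrite phiM phi_XJ.
- by rewrite -[X in ishomog1 X _](subnKC Jn) dhomogM // XJ_homog.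
- by rewrite lap_XJ // lG mulr0.
move=> mu hmu i iB; move: hmu; rewrite -mcoeff_msupp mulrC XJE.
rewrite (perm_mem (msuppMX _ _)) => /mapP[nu hnu ->]; rewrite mnmDE mnmE.
have [//|iJ] := boolP (i \in J); rewrite add0n; apply/negbTE; rewrite -leqNgt leqn0.
(* A monomial of [G] containing [X_i] would leave a nonzero coefficient in [d_i G], since the
   characteristic is 0. *)
apply/negPn/negP => nui; have := dG i.
rewrite !inE iJ => /(_ _)/(congr1 (mcoeff (mnm_sub nu (mnm1 i)))).
rewrite mcoeff_mderiv mcoeff0 submK; last first.
  by apply/mnm_lepP => j; rewrite mnm1E; case: eqP => // <-; rewrite lt0n.
move: iB hnu; rewrite inE mcoeff_msupp => iB hnu /(_ iB) /eqP.
by rewrite mulrn_eq0 /= (negbTE hnu).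
Qed.

(** The number of monomials of degree [n - j] in [d - (k - j)] variables. The subtraction truncates:
    for [k = d + 1] and [j <= 1] no variable is left, which gives 0 in positive degree. *)
Definition face_dim j : nat := if (j <= n)%N then 'C(n - j + (d - (k - j)) - 1, n - j) else 0.

Lemma face_has_dim J : admissible J -> has_dim (face J) (face_dim #|J|).
Proof.
move=> /andP[JB adm]; apply: has_dim_mulsp; first exact: xJ_neq0.
have cBJ : #|B :\: J| = (k - #|J|)%N.
  by rewrite cardsD (finset.setIidPr JB) card_B.
rewrite /face_dim; case: ifPn => Jn; last first.
  by apply: has_dim_zero => p; rewrite subz_Negz // ltnNge.
rewrite subz_Posz //; have [cS|cS] := ltnP #|B :\: J| d.
  by have := Hsp_dim (n - #|J|) cS (epsJ_gt J (rS (B :\: J))); rewrite cBJ.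
move: adm; rewrite ltnNge cS /= => nJ.
have -> : 'C(n - #|J| + (d - (k - #|J|)) - 1, n - #|J|) = 0%N.
  by apply: bin_small; move: cS nJ; rewrite cBJ; move: #|J| => j; lia.
by apply: has_dim_zero => p; rewrite /Hsp cS.
Qed.

Lemma xJ0 : xJ R (finset.set0 : {set 'I_d.+1}) = 1.
Proof. by rewrite /xJ big_set0. Qed.

Definition faces : seq {set 'I_d.+1} :=
  if (k <= d)%N then
    B :: enum [set J : {set 'I_d.+1} | (J \subset B) && (1 <= #|J| <= k.-1)%N]
      ++ [:: finset.set0]
  else [set: 'I_d.+1]%SET :: enum [set J : {set 'I_d.+1} | (2 <= #|J| <= d)%N].

(** For [J = B] the face set [B :\: J] is empty and the exponents are above -1, so [Vsp_Hsp] makes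
    the orthogonal summand one more [face]. *)
Lemma mulsp_V_face p :
  mulsp (xJ R B) (Vsp (gvec gam k 1) (n%:Z - k%:Z)) p <-> face B p.
Proof.
rewrite /face card_B finset.setDv.
have -> : epsJ gam k B = gvec gam k 1.
  apply/funext => i; rewrite /epsJ /gvec; case: ifPn => //.
  by rewrite inE -leqNgt => ->.
have g1 i : -1 < gvec gam k 1 i.
  by rewrite /gvec; case: ifP => [/gam1//|_]; lra.
have E u : Vsp (gvec gam k 1) (n%:Z - k%:Z) u <->
    Hsp finset.set0 (gvec gam k 1) (n%:Z - k%:Z) u.
  by case: (n%:Z - k%:Z) => m //; apply: Vsp_Hsp => //; exact: ltnW.
by split=> -[u [/E hu ->]]; exists u.
Qed.

(** Merges the different shapes of the family into a list of sets [J]. For [k = d + 1] the set [B]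
    is everything, so the complement of [J] is [B :\: J]; for [J] empty the factor [xJ] is 1. *)
Lemma Ufam_faces : List.Forall2 (fun (U : Defs.space R d) J => forall p, U p <-> face J p)
  (Ufam gam k n) faces.
Proof.
have k1 : (k <= d.+1)%N by have /andP[] := kd.
have map_faces (f : {set 'I_d.+1} -> {set 'I_d.+1}) (s : seq {set 'I_d.+1}) :
    (forall J, f J = B :\: J) -> List.Forall2
    (fun (U : Defs.space R d) J => forall p, U p <-> face J p)
    [seq mulsp (xJ R J) (Hsp (f J) (epsJ gam k J) (n%:Z - #|J|%:Z)) | J <- s] s.
  move=> fE; elim: s => [|J s IH]; first by constructor.
  by constructor; [move=> p; rewrite /face -fE; exact: iff_refl|exact: IH].
have [kd'|kd'] := leqP k d.
  have -> : Ufam gam k n = mulsp (xJ R B) (Vsp (gvec gam k 1) (n%:Z - k%:Z)) ::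
      [seq mulsp (xJ R J) (Hsp (B :\: J) (epsJ gam k J) (n%:Z - #|J|%:Z))
       | J <- enum [set J : {set 'I_d.+1} | (J \subset B) && (1 <= #|J| <= k.-1)%N]]
      ++ [:: Hsp B (gvec gam k 0) n%:Z] by rewrite /Ufam kd'.
  rewrite /faces kd'; constructor; first by move=> p; exact: mulsp_V_face.
  apply: List.Forall2_app; first exact: (map_faces (fun J => B :\: J)).
  constructor; last by constructor.
  move=> p; rewrite /face finset.setD0 cards0 xJ0 subr0.
  have -> : epsJ gam k finset.set0 = gvec gam k 0.
    by apply/funext => i; rewrite /epsJ /gvec finset.in_set0.
  by split=> [h|[u [hu ->]]]; [exists p|]; rewrite mul1r.
have kE : k = d.+1 by apply/eqP; rewrite eqn_leq k1.
have BT : B = [set: 'I_d.+1]%SET.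
  by apply/setP => i; rewrite !inE kE subnn.
have -> : Ufam gam k n = mulsp (xJ R [set: 'I_d.+1]%SET) (Vsp (fun _ => 1) (n%:Z - d.+1%:Z)) ::
    [seq mulsp (xJ R J) (Hsp (~: J) (epsJ gam k J) (n%:Z - #|J|%:Z))
       | J <- enum [set J : {set 'I_d.+1} | (2 <= #|J| <= d)%N]].
  by rewrite /Ufam leqNgt kd'.
rewrite /faces leqNgt kd'; constructor.
  move=> p; have := mulsp_V_face p; rewrite BT kE => <-.
  have -> // : gvec gam d.+1 1 = (fun=> 1).
  by apply/funext => i; rewrite /gvec subnn.
by apply: (map_faces (fun J => ~: J)) => J; rewrite BT finset.setTD.
Qed.

Lemma Forall2_nth (T1 T2 : Type) (P : T1 -> T2 -> Prop) s1 s2 x1 x2 :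
  List.Forall2 P s1 s2 -> size s1 = size s2 /\
  forall i, (i < size s1)%N -> P (nth x1 s1 i) (nth x2 s2 i).
Proof.
elim=> [|a b s t Pab _ [st IH]]; first by split.
by split=> [|[|i]] //=; [rewrite st|exact: IH].
Qed.

Hypothesis nk : ((k <= d) && (1 <= n))%N || ((k == d.+1) && (2 <= n))%N.

Lemma faces_uniq : uniq faces.
Proof.
have /andP[k0 _] := kd.
rewrite /faces; case: ifPn => kd' /=.
  rewrite cat_uniq enum_uniq /= !andbT mem_cat mem_enum !inE /= negb_or.
  rewrite mem_enum inE cards0 ltnn andbF /= andbT.
  rewrite card_B subxx k0 /= -ltnNge prednK // leqnn /=.
  by rewrite -card_gt0 card_B.
by rewrite enum_uniq andbT mem_enum inE cardsT card_ord ltnn andbF.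
Qed.

Lemma faces_admissible J : J \in faces -> admissible J.
Proof.
have /andP[k0 k1] := kd.
have cBJ J' : J' \subset B -> #|B :\: J'| = (k - #|J'|)%N.
  by move=> JB; rewrite cardsD (finset.setIidPr JB) card_B.
rewrite /faces /admissible; case: ifPn => kd'.
  rewrite inE mem_cat mem_enum !inE => /predU1P[->|/orP[/andP[JB h]|/eqP ->]].
  - by rewrite subxx finset.setDv cards0 (ltn_trans _ d2).
  - rewrite JB cBJ //=; apply/orP; left; move: h kd'; move: #|J| => j; lia.
  - rewrite finset.sub0set cards0 subn0; apply/orP; right.
    by move: nk; rewrite kd' /= => /orP[//|/andP[/eqP]]; lia.
have kE : k = d.+1 by apply/eqP; rewrite eqn_leq k1 ltnNge.
have BT : B = [set: 'I_d.+1]%SET by apply/setP => i; rewrite !inE kE subnn.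
rewrite inE mem_enum inE => /predU1P[->|h].
  by rewrite BT subxx finset.setDv cards0 (ltn_trans _ d2).
have JB : J \subset B by rewrite BT finset.subsetT.
by rewrite JB cBJ //= kE; apply/orP; left; move: h; move: #|J| => j; lia.
Qed.

(* If [k = d.+1] the subsets with at most one element are missing from the sum. *)
Lemma sum_faces (f : nat -> nat) : ((d < k)%N -> f 0%N = 0%N /\ f 1%N = 0%N) ->
  (\sum_(J <- faces) f #|J| = \sum_(j < k.+1) 'C(k, j) * f j)%N.
Proof.
move=> f01; have /andP[k0 k1] := kd.
have -> : (\sum_(j < k.+1) 'C(k, j) * f j = \sum_(J : {set 'I_d.+1} | J \subset B) f #|J|)%N.
  rewrite (partition_big (fun J : {set 'I_d.+1} => inord #|J| : 'I_k.+1) xpredT) //=.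
  apply: eq_bigr => j _; rewrite -{1}card_B -cards_draws -sum1_card big_distrl /=.
  rewrite big_mkcond [RHS]big_mkcond; apply: eq_bigr => J _; rewrite inE.
  case: (boolP (J \subset B)) => //= JB.
  have Jk : (#|J| < k.+1)%N by rewrite ltnS -card_B subset_leq_card.
  by rewrite -val_eqE /= inordK //; case: eqP => // ->; rewrite mul1n.
have big_faces (P : pred {set 'I_d.+1}) : perm_eq faces (enum P) ->
    (\sum_(J <- faces) f #|J| = \sum_(J in P) f #|J|)%N.
  by move=> h; rewrite (perm_big _ h) big_enum.
have [kd'|kd'] := leqP k d.
  rewrite (big_faces [pred J : {set 'I_d.+1} | J \subset B]) //.
  apply: uniq_perm; rewrite ?faces_uniq ?enum_uniq // => J.
  rewrite mem_enum /faces kd' !inE mem_cat mem_enum !inE.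
  have [->|JneB] := eqVneq J B; first by rewrite subxx.
  have [->|J0] := eqVneq J finset.set0; first by rewrite finset.sub0set !orbT.
  rewrite /= orbF; case: (boolP (J \subset B)) => //= JB.
  rewrite card_gt0 J0 /= -ltnS prednK //.
  have : J \proper B by rewrite finset.properEneq JneB.
  by move/proper_card; rewrite card_B.
have [f0 f1] := f01 kd'.
have kE : k = d.+1 by apply/eqP; rewrite eqn_leq k1.
have BT : B = [set: 'I_d.+1]%SET by apply/setP => i; rewrite !inE kE subnn.
rewrite (big_faces [pred J : {set 'I_d.+1} | (1 < #|J|)%N]) //; last first.
  apply: uniq_perm; rewrite ?faces_uniq ?enum_uniq // => J.
  rewrite mem_enum /faces leqNgt kd' /= !inE mem_enum !inE.
  have [->|JneB] := eqVneq J finset.setT.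
    by rewrite cardsT card_ord (ltnW d2 : (1 < d.+1)%N).
  rewrite /=; case: (1 < #|J|)%N => //=.
  have : J \proper [set: 'I_d.+1]%SET by rewrite finset.properEneq JneB finset.subsetT.
  by move/proper_card; rewrite cardsT card_ord ltnS.
rewrite big_mkcond [RHS]big_mkcond; apply: eq_bigr => J _.
rewrite BT finset.subsetT inE; case: ltnP => //.
by case: #|J| => [|[|]].
Qed.

(** The upper index [(n - j) + (d - (k - j)) - 1] equals [n + d - k - 1] for every [j], so the sum
    is a Vandermonde convolution with total [k + (n + d - k - 1) = n + d - 1]. Where [d - (k - j)]
    truncates, both binomials are 0. *)
Lemma Vandermonde_face : (\sum_(j < k.+1) 'C(k, j) * face_dim j = 'C(n + d - 1, n))%N.
Proof.
have /andP[k0 k1] := kd.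
have n0 : (0 < n)%N by move: nk => /orP[/andP[_ //]|/andP[_]]; exact: ltnW.
have fE j : (j <= k)%N -> face_dim j = if (j <= n)%N then 'C(n + d - k - 1, n - j) else 0%N.
  move=> jk; rewrite /face_dim; case: ifPn => // jn.
  have [kd'|kd'] := leqP (k - j) d.
    by congr 'C(_, _); lia.
  by rewrite !bin_small //; lia.
transitivity (\sum_(j < n.+1) 'C(k, j) * 'C(n + d - k - 1, n - j))%N; last first.
  rewrite binomial.Vandermonde; congr 'C(_, _).
  by move: nk => /orP[/andP[a b]|/andP[/eqP a b]]; lia.
(* The two sums end at [k] and at [n]; both are extended to [k + n], the added terms vanishing
   through one binomial or the other. *)
pose g j := ('C(k, j) * if (j <= n)%N then 'C(n + d - k - 1, n - j) else 0)%N.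
transitivity (\sum_(j < (k + n).+1) g j)%N.
  rewrite (big_ord_widen (k + n).+1 (fun j => ('C(k, j) * face_dim j)%N)); last first.
    by rewrite ltnS leq_addr.
  rewrite big_mkcond; apply: eq_bigr => j _; rewrite ltnS /g.
  by case: leqP => jk; [rewrite fE|rewrite bin_small].
rewrite [RHS](big_ord_widen (k + n).+1 (fun j => ('C(k, j) * 'C(n + d - k - 1, n - j))%N)).
  rewrite [RHS]big_mkcond; apply: eq_bigr => j _; rewrite ltnS /g.
  by case: leqP; rewrite ?muln0.
by rewrite ltnS leq_addl.
Qed.

Lemma Ufam_nth : size (Ufam gam k n) = size faces /\
  forall i, (i < size (Ufam gam k n))%N ->
    forall p, nth (@zsp R d) (Ufam gam k n) i p <-> face (nth finset.set0 faces i) p.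
Proof. exact: Forall2_nth Ufam_faces. Qed.

Lemma Ufam_lift (i : 'I_(size (Ufam gam k n))) p :
  nth (@zsp R d) (Ufam gam k n) i p -> exists F,
  [/\ p = phi F, F \is homog n, lap e1 F = 0
    & forall mu, mcoeff mu F != 0 ->
        forall j, j \in B -> (0 < mu j)%N = (j \in nth finset.set0 faces i)].
Proof.
have [sz H] := Ufam_nth; move/(H i (ltn_ord i)); apply: face_lift.
have /faces_admissible/andP[//] : nth finset.set0 faces i \in faces.
by rewrite mem_nth // -sz.
Qed.

Lemma Ufam_direct : direct (Ufam gam k n).
Proof.
move=> u hu s0 i0; have [sz H] := Ufam_nth.
have [F HF] := dep_choice (fun i => Ufam_lift (hu i)).
have sF : \sum_i F i = 0.
  apply: (@phi_inj _ _ n); first by apply: homog_sum => i _; have [] := HF i.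
  by rewrite phi_sum -[RHS]s0; apply: eq_bigr => i _; have [<-] := HF i.
have [-> _ _ supp0] := HF i0; suff -> : F i0 = 0 by rewrite phi0.
apply/mpolyP => mu; rewrite mcoeff0; apply/eqP/negPn/negP => h0.
have := congr1 (mcoeff mu) sF; rewrite (raddf_sum (mcoeff mu)) mcoeff0 (bigD1 i0) //=.
rewrite big1 ?addr0 => [E|i ii0]; first by rewrite E eqxx in h0.
apply/eqP/negPn/negP => h1; have [_ _ _ suppi] := HF i.
have inB (l : 'I_(size (Ufam gam k n))) j : j \in nth finset.set0 faces l -> j \in B.
  have /faces_admissible/andP[/fintype.subsetP sub _] : nth finset.set0 faces l \in faces.
    by rewrite mem_nth // -sz.
  exact: sub.
(* The common monomial [mu] shows the same variables of [B] to both summands, so their sets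
   coincide, and no set is listed twice. *)
move/negP: ii0; apply; rewrite -val_eqE /=.
rewrite -(nth_uniq finset.set0 _ _ faces_uniq) -?sz //.
apply/eqP/setP => j; have [jB|jB] := boolP (j \in B).
  by rewrite -(suppi mu h1 j jB) -(supp0 mu h0 j jB).
by apply/idP/idP => /inB h; rewrite h in jB.
Qed.

Lemma sumsp_Ufam_lift p : sumsp (Ufam gam k n) p ->
  exists F, [/\ p = phi F, F \is homog n & lap e1 F = 0].
Proof.
move=> [u [hu ->]]; have [F HF] := dep_choice (fun i => Ufam_lift (hu i)).
exists (\sum_i F i); split.
- by rewrite phi_sum; apply: eq_bigr => i _; have [<-] := HF i.
- by apply: homog_sum => i _; have [] := HF i.
- by rewrite lap_sum big1 // => i _; have [] := HF i.
Qed.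

Lemma has_dim_sumsp_Ufam : has_dim (sumsp (Ufam gam k n)) 'C(n + d - 1, n).
Proof.
have [sz H] := Ufam_nth.
have f01 : (d < k)%N -> face_dim 0 = 0%N /\ face_dim 1 = 0%N.
  move=> dk; have n2 : (1 < n)%N by move: nk; rewrite leqNgt dk /= => /andP[].
  have face_dim0 j : (j <= 1)%N -> face_dim j = 0%N.
    by move=> j1; rewrite /face_dim; case: (j <= n)%N => //; apply: bin_small; lia.
  by split; exact: face_dim0.
rewrite -Vandermonde_face -(sum_faces f01).
have -> : (\sum_(J <- faces) face_dim #|J| =
    \sum_(i < size (Ufam gam k n)) face_dim #|nth finset.set0 faces i|)%N.
  by rewrite (big_nth finset.set0) big_mkord sz.
apply: has_dim_sumsp; first exact: Ufam_direct.
- move=> i; have h := H i (ltn_ord i).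
  have [s0 sZ] : subspace (face (nth finset.set0 faces i)).
    by apply: subspace_mulsp; exact: subspace_Hsp.
  split; first exact/h.
  by move=> c p q /h hp /h hq; apply/h; exact: sZ.
- move=> i; have h := H i (ltn_ord i); apply: (has_dim_ext (fun p => iff_sym (h p))).
  by apply: face_has_dim; apply: faces_admissible; rewrite mem_nth // -sz.
Qed.

End FaceDecomposition.

Lemma Lop_eigen (R : realType) (d k n : nat) (gam : 'I_d.+1 -> R) (F : mpoly d.+1 R) :
  (1 <= k <= d.+1)%N -> F \is homog n -> lap (gvec gam k (-1)) F = 0 ->
  Lop (gvec gam k (-1)) (phi F) =
  (- (n%:R * (n%:R + abs_gam gam k + d%:R - k%:R))) *: phi F.
Proof.
move=> kd hF lF; rewrite (Lop_phi _ hF) lF phi0 sub0r -scaleNr gvec_sum //.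
by congr (_ *: _); ring.
Qed.

(** * Degree one when all exponents are -1 *)

Section LinearForms.
Variables (R : realType) (d : nat).
Local Notation wid := (widen_ord (leqnSn d)).

Lemma spanL_codom (f : 'I_d -> mpoly d R) p :
  (exists a : 'I_d -> R, p = \sum_(i | predT i) a i *: f i) <->
  spanL [seq f i | i <- enum 'I_d] p.
Proof.
set s := map _ _; have sz : size s = d by rewrite size_map -cardE card_ord.
have sE (j : 'I_(size s)) : s`_j = f (cast_ord sz j).
  have jd : (j < d)%N by rewrite -[X in (_ < X)%N]sz.
  rewrite (nth_map (cast_ord sz j)) -?cardE ?card_ord //; congr f; apply: val_inj.
  by rewrite /= nth_enum_ord.
split=> -[a ->].
  exists (fun j => a (cast_ord sz j)); rewrite (reindex (cast_ord sz)) /=; last first.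
    by exists (cast_ord (esym sz)) => j _; rewrite ?cast_ordK ?cast_ordKV.
  by apply: eq_bigr => j _; rewrite sE.
exists (fun i => a (cast_ord (esym sz) i)).
rewrite [RHS](reindex (cast_ord sz)) /=; last first.
  by exists (cast_ord (esym sz)) => j _; rewrite ?cast_ordK ?cast_ordKV.
by apply: eq_bigr => j _; rewrite sE cast_ordK.
Qed.

Lemma has_dim_affine (c : 'I_d -> R) :
  has_dim (spanL [seq Xv R i + Defs.cst d (c i) | i <- enum 'I_d]) d.
Proof.
apply: (has_dim_ext (spanL_codom _)).
rewrite -[X in has_dim _ X](card_ord d); apply: has_dim_span => a h i _.
have := congr1 (mcoeff (mnm1 i)) h; rewrite raddf_sum mcoeff0 /= (bigD1 i) //=.
have coefE j : mcoeff (mnm1 i) (a j *: (Xv R j + Defs.cst d (c j))) = a j * (j == i)%:R.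
  rewrite mcoeffZ mcoeffD mcoeffX mcoeffC mnm1_eq0 mulr0 addr0.
  congr (_ * (nat_of_bool _)%:R); apply/eqP/eqP => [/mnmP/(_ i)|->//].
  by rewrite !mnm1E eqxx; case: eqP.
rewrite coefE eqxx mulr1 big1 ?addr0 // => j /negbTE ji.
by rewrite coefE ji mulr0.
Qed.

(** With all exponents -1 the operator [lap] has no first-order part and annihilates every linear
    form. This is why the constants are arbitrary: [x_i + c_i] lifts to [X_i] plus [c_i] times the
    sum of all variables. *)
Lemma affine_lift (c : 'I_d -> R) p :
  spanL [seq Xv R i + Defs.cst d (c i) | i <- enum 'I_d] p ->
  exists F, [/\ p = phi F, F \is homog 1 & lap (fun=> -1) F = 0].
Proof.
move=> /spanL_codom[a ->].
pose G i : mpoly d.+1 R := XU (wid i) + c i *: \sum_l XU l.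
have hG i : G i \is homog 1.
  rewrite /G dhomogD ?homog_XU // dhomogZ //; apply: homog_sum => l _; exact: homog_XU.
exists (\sum_i a i *: G i); split.
- rewrite phi_sum; apply: eq_bigr => i _; rewrite phiZ phiD phiXU Xp_widen phiZ.
  rewrite phi_sum sum_wid (eq_bigr (fun j => Xv R j)) => [|j _]; last first.
    by rewrite phiXU Xp_widen.
  by rewrite phiXU Xp_max subrKC /Defs.cst -alg_mpolyC.
- by apply: homog_sum => i _; rewrite dhomogZ.
- rewrite lap_sum big1 // => i _; rewrite lapZ.
  suff -> : lap (fun=> -1) (G i) = 0 by rewrite scaler0.
  rewrite /lap big1 // => j _; rewrite addNr mpolyC0 mul0r addr0.
  by rewrite (homog0_mderiv _ (homog_mderiv j (hG i))) mulr0.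
Qed.

End LinearForms.

Theorem theorem3p5 (R : realType) (d k : nat) (gam : 'I_d.+1 -> R)
    (c : 'I_d -> R) (n : nat) :
  (2 <= d)%N -> (1 <= k <= d.+1)%N ->
  (forall i : 'I_d.+1, (i < d.+1 - k)%N -> -1 < gam i) ->
  [/\ (forall u : mpoly.mpoly d R, Usp gam c k n u ->
         Lop (gvec gam k (-1)) u
         = (- (n%:R * (n%:R + abs_gam gam k + d%:R - k%:R))) *: u),
      has_dim (Usp gam c k n) 'C(n + d - 1, n)
    & ((k <= d)%N && (1 <= n)%N) || ((k == d.+1) && (2 <= n)%N) ->
      direct (Ufam gam k n)].
Proof.
move=> d2 kd gam1.
have [n0|n0] := eqVneq n 0%N.
  have lap1 e : lap e (1 : mpoly d.+1 R) = 0.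
    by rewrite /lap big1 // => i _; rewrite -mpolyC1 !mderivC ?mderiv0 !mulr0 addr0.
  rewrite n0 /Usp eqxx !andbF; split=> //.
    move=> u [a ->]; rewrite big_ord1 /= -phi1 -phiZ.
    apply: Lop_eigen => //; first by apply: dhomogZ; exact: dhomog1.
    by rewrite lapZ lap1 scaler0.
  rewrite bin0; apply: (@has_dim_spanL R d [:: 1]) => a.
  rewrite big_ord1 /= => h i; rewrite (ord1 i).
  have := congr1 (mcoeff mnm0) h; rewrite mcoeffZ mcoeff1 eqxx mulr1 mcoeff0.
  by [].
have [kn|kn] := boolP ((k == d.+1) && (n == 1%N)).
  have [/eqP kE /eqP nE] := andP kn.
  rewrite /Usp (negbTE n0) kn; split; last 2 first.
  - rewrite nE add1n subn1 /= bin1; exact: has_dim_affine.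
  - by rewrite kE nE ltnn andbF.
  move=> u /affine_lift[F [-> hF lF]]; rewrite nE; apply: Lop_eigen => //.
  rewrite -[RHS]lF; apply: lap_eq => i; rewrite /gvec kE subnn //.
have nk : ((k <= d) && (1 <= n) || (k == d.+1) && (2 <= n))%N.
  move: kd kn n0 => /andP[_]; rewrite leq_eqVlt ltnS.
  case: eqP => [->|_] /=; first by rewrite ltnn /=; case: (n) => [|[|]].
  by move=> -> _; rewrite lt0n => ->.
have E : Usp gam c k n = sumsp (Ufam gam k n).
  by rewrite /Usp (negbTE n0) (negbTE kn).
rewrite E; split.
- by move=> u /(sumsp_Ufam_lift d2 kd gam1 nk)[F [-> hF lF]]; exact: Lop_eigen.
- exact: has_dim_sumsp_Ufam.
- by move=> _; exact: Ufam_direct.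
Qed.
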